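(* Let $K$ be a field of characteristic $0$. One has ${}^{p}\mathrm{U}(\mathbb{G}_a)=\mathbb{G}_a$ and ${}^{p}\mathrm{Red}(\mathbb{G}_a)=SL_2$. More precisely, for every monoidal section $s$ of the projection $\pi_{\mathbb{G}_a}:\mathrm{Rep}_K(\mathbb{G}_a)\to\mathrm{Rep}_K(\mathbb{G}_a)/\mathrm{rad}$, there exists an isomorphism of $(\mathbb{G}_a)_s$ with $SL_2$ such that $s^\sharp=\phi$, where $\phi:\mathbb{G}_a\to SL_2$ is the homomorphism $a\mapsto\begin{pmatrix}1&a\\0&1\end{pmatrix}$.
   Context: For an affine $K$-group $G$, let $\mathcal{A}=\mathrm{Rep}_K(G)$ be the category of finite-dimensional representations, $\omega_G:\mathcal{A}\to\mathrm{Vec}_K$ the forgetful functor, $\mathcal{R}=\mathrm{rad}(\mathcal{A})$ the radical, $\mathcal{R}(A,B)=\{f:\forall g:B\to A,\ 1_A-gf\text{ invertible}\}$. In characteristic $0$, $\mathcal{R}$ is stable under tensoring with objects and $\bar{\mathcal{A}}=\mathcal{A}/\mathcal{R}$ is a semisimple neutral Tannakian category; let $\pi_G:\mathcal{A}\to\bar{\mathcal{A}}$ be the projection. A monoidal section $s$ of $\pi_G$ is a $K$-linear monoidal functor $s:\bar{\mathcal{A}}\to\mathcal{A}$ with $\pi_G\circ s=\mathrm{id}$ as monoidal functors; such sections exist, are automatically symmetric, and any two are conjugate by a monoidal isomorphism projecting to the identity in $\bar{\mathcal{A}}$. Put $\omega_s=\omega_G\circ s$, a fibre functor on $\bar{\mathcal{A}}$,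 and $G_s=\underline{\mathrm{Aut}}^{\otimes}(\omega_s)$, a pro-reductive $K$-group; $s^\sharp:G\cong\underline{\mathrm{Aut}}^{\otimes}(\omega_G)\to\underline{\mathrm{Aut}}^{\otimes}(\omega_s)=G_s$ is the evident homomorphism (a closed immersion). The pro-reductive envelope ${}^{p}\mathrm{Red}(G)$ is $G_s$ (well defined up to isomorphism, uniquely up to conjugation by $K$-points), with the embedding $s^\sharp$; it is the value at $G$ of the left adjoint of the inclusion of the category of pro-reductive $K$-groups, with homomorphisms up to conjugation by $K$-points of the target, into that of affine $K$-groups. The unipotent complement ${}^{p}\mathrm{U}(G)$ is the pro-unipotent $K$-group $U_s$ whose points over an extension $L/K$ are the monoidal automorphisms of $s$ (with scalars extended to $L$) that project to the identity in $\bar{\mathcal{A}}$; it embeds in $G_s$ via $\omega_G$ and centralizes $G$.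
   Formalization: Monoidal sections are required to be compatible with the symmetry; this is not automatic: deforming the invariant e1⊗e2−e2⊗e1 of V⊗V by c·e1⊗e1 (c≠0) gives a nonsymmetric section whose group is {±1}×G_a, not SL_2. *)

(* Defs.v *)
From HB Require Import structures.
From mathcomp Require Import all_boot all_order all_algebra.
From mathcomp Require Import boolp mxtens.

Set Implicit Arguments.
Unset Strict Implicit.
Unset Printing Implicit Defensive.

Import GRing.Theory.
Local Open Scope ring_scope.

(* groupType cannot be used here: it contains an eqType, and the groups of    *)
(* monoidal automorphisms below live in a universe above the one of eqType,   *)
(* since their elements are indexed by representations, which quantify over   *)
(* all commutative algebras.                                                  *)
Record group := Group {
  gcar :> Type;
  gone : gcar;
  gmul : gcar -> gcar -> gcar;
  gmulA : forall x y z, gmul x (gmul y z) = gmul (gmul x y) z;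
  gmul1x : forall x, gmul gone x = x;
  gmulx1 : forall x, gmul x gone = x;
  gmulV : forall x, exists y, gmul x y = gone /\ gmul y x = gone
}.
Arguments gone {g}.
Arguments gmul {g} x y.

(* Affine K-groups are handled as functors from commutative K-algebras to     *)
(* groups, of which they form a full subcategory by Yoneda. The algebras of   *)
(* comAlgType K are the nonzero ones; omitting the zero algebra is harmless   *)
(* because an affine group has exactly one point there.                       *)
Record kgroup (K : fieldType) := KGroup {
  kpts :> comAlgType K -> group;
  kmap : forall R S : comAlgType K, {lrmorphism R -> S} -> kpts R -> kpts S;
  kmapM : forall (R S : comAlgType K) (f : {lrmorphism R -> S}) x y,
    kmap f (gmul x y) = gmul (kmap f x) (kmap f y);
  kmap_id : forall (R : comAlgType K) (x : kpts R),
    kmap (idfun : {lrmorphism R -> R}) x = x;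
  kmap_comp : forall (R S T : comAlgType K) (f : {lrmorphism R -> S})
      (g : {lrmorphism S -> T}) x,
    kmap (g \o f : {lrmorphism R -> T}) x = kmap g (kmap f x)
}.
Arguments kmap {K} _ {R S} f x.

Record khom (K : fieldType) (G H : kgroup K) := KHom {
  kapp :> forall R : comAlgType K, G R -> H R;
  kappM : forall (R : comAlgType K) (x y : G R),
    kapp (gmul x y) = gmul (kapp x) (kapp y);
  kapp_nat : forall (R S : comAlgType K) (f : {lrmorphism R -> S}) (x : G R),
    kapp (kmap G f x) = kmap H f (kapp x)
}.
Arguments kapp {K G H} _ R _.

Definition kiso (K : fieldType) (G H : kgroup K) (f : khom G H) : Prop :=
  forall R : comAlgType K, bijective (f R).

Lemma sig_eqP (T : Type) (P : T -> Prop) (x y : {t : T | P t}) :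
  sval x = sval y -> x = y.
Proof. by case: x y => [x px] [y py] /= e; apply: eq_exist. Qed.

Section AdditiveGroup.
Variable K : fieldType.

Lemma ga_addV (R : comAlgType K) (a : R) :
  exists b : R, a + b = 0 /\ b + a = 0.
Proof. by exists (- a); rewrite addrN addNr. Qed.

Definition ga_pts (R : comAlgType K) : group :=
  @Group R 0 +%R (@addrA R) (@add0r R) (@addr0 R) (@ga_addV R).

Definition ga_map (R S : comAlgType K) (f : {lrmorphism R -> S}) :
  ga_pts R -> ga_pts S := f.

Lemma ga_mapM (R S : comAlgType K) (f : {lrmorphism R -> S}) (x y : ga_pts R) :
  ga_map f (gmul x y) = gmul (ga_map f x) (ga_map f y).
Proof. exact: rmorphD. Qed.

Definition Ga : kgroup K :=
  @KGroup K ga_pts ga_map ga_mapM (fun _ _ => erefl) (fun _ _ _ _ _ _ => erefl).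

End AdditiveGroup.

Section SpecialLinearGroup.
Variable K : fieldType.

Section Points.
Variable R : comAlgType K.

Definition sl2_car : Type := {M : 'M[R]_2 | \det M = 1}.
Implicit Types M N : sl2_car.

Definition mk_sl2 (M : 'M[R]_2) (d1 : \det M = 1) : sl2_car := exist _ M d1.

Lemma sl2_mul_subproof M N : \det (sval M *m sval N) = 1.
Proof. by rewrite det_mulmx (svalP M) (svalP N) mulr1. Qed.
Lemma sl2_inv_subproof M : \det (\adj (sval M)) = 1.
Proof.
have := congr1 (@determinant _ _) (mul_mx_adj (sval M)).
by rewrite det_mulmx (svalP M) mul1r det1 => ->.
Qed.

Definition sl2_one : sl2_car := mk_sl2 (det1 _ _).
Definition sl2_mul M N : sl2_car := mk_sl2 (sl2_mul_subproof M N).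

Lemma sl2_mulA M N P : sl2_mul M (sl2_mul N P) = sl2_mul (sl2_mul M N) P.
Proof. by apply: sig_eqP; apply: mulmxA. Qed.
Lemma sl2_mul1x M : sl2_mul sl2_one M = M.
Proof. by apply: sig_eqP; apply: mul1mx. Qed.
Lemma sl2_mulx1 M : sl2_mul M sl2_one = M.
Proof. by apply: sig_eqP; apply: mulmx1. Qed.
Lemma sl2_mulV M : exists N, sl2_mul M N = sl2_one /\ sl2_mul N M = sl2_one.
Proof.
exists (mk_sl2 (sl2_inv_subproof M)); split; apply: sig_eqP => /=.
  by rewrite mul_mx_adj (svalP M).
by rewrite mul_adj_mx (svalP M).
Qed.

Definition sl2_pts : group := Group sl2_mulA sl2_mul1x sl2_mulx1 sl2_mulV.
End Points.

Lemma sl2_map_subproof (R S : comAlgType K) (f : {lrmorphism R -> S})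
  (M : sl2_pts R) : \det (map_mx f (sval M)) = 1.
Proof. by rewrite det_map_mx (svalP M) rmorph1. Qed.

Definition sl2_map (R S : comAlgType K) (f : {lrmorphism R -> S})
  (M : sl2_pts R) : sl2_pts S := mk_sl2 (sl2_map_subproof f M).

Lemma sl2_mapM (R S : comAlgType K) (f : {lrmorphism R -> S})
  (M N : sl2_pts R) : sl2_map f (gmul M N) = gmul (sl2_map f M) (sl2_map f N).
Proof. by apply: sig_eqP; apply: map_mxM. Qed.
Lemma sl2_map_id (R : comAlgType K) (M : sl2_pts R) :
  sl2_map (idfun : {lrmorphism R -> R}) M = M.
Proof. by apply: sig_eqP; apply: map_mx_id. Qed.
Lemma sl2_map_comp (R S T : comAlgType K) (f : {lrmorphism R -> S})
  (g : {lrmorphism S -> T}) (M : sl2_pts R) :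
  sl2_map (g \o f : {lrmorphism R -> T}) M = sl2_map g (sl2_map f M).
Proof. by apply: sig_eqP; apply/matrixP => i j; rewrite !mxE. Qed.

Definition SL2 : kgroup K :=
  @KGroup K sl2_pts sl2_map sl2_mapM sl2_map_id sl2_map_comp.

Definition phi_mx (R : comAlgType K) (a : R) : 'M[R]_2 :=
  block_mx (1%:M : 'M_1) a%:M 0 (1%:M : 'M_1).

Lemma phi_subproof (R : comAlgType K) (a : R) : \det (phi_mx a) = 1.
Proof. by rewrite (det_ublock (1%:M : 'M_1)) !det1 mulr1. Qed.
Lemma phi_mxD (R : comAlgType K) (a b : R) :
  phi_mx (a + b) = phi_mx a *m phi_mx b.
Proof.
apply: etrans (esym (@mulmx_block _ 1 1 1 1 1 1 _ _ _ _ _ _ _ _)).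
rewrite !mul1mx !mulmx1 !mul0mx !mulmx0 !addr0 !add0r.
by rewrite addrC -raddfD.
Qed.
Lemma phi_mx_nat (R S : comAlgType K) (f : {lrmorphism R -> S}) (a : R) :
  phi_mx (f a) = map_mx f (phi_mx a).
Proof.
apply: etrans (esym (@map_block_mx _ _ _ 1 1 1 1 _ _ _ _)).
by rewrite map_mx1 map_mx0 map_scalar_mx.
Qed.

Definition phi_fun (R : comAlgType K) (a : Ga K R) : SL2 R :=
  mk_sl2 (phi_subproof a).

Lemma phiM (R : comAlgType K) (a b : Ga K R) :
  phi_fun (gmul a b) = gmul (phi_fun a) (phi_fun b).
Proof. by apply: sig_eqP; apply: phi_mxD. Qed.
Lemma phi_nat (R S : comAlgType K) (f : {lrmorphism R -> S}) (a : Ga K R) :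
  phi_fun (kmap (Ga K) f a) = kmap SL2 f (phi_fun a).
Proof. by apply: sig_eqP; apply: phi_mx_nat. Qed.

Definition phi : khom (Ga K) SL2 := @KHom K _ _ phi_fun phiM phi_nat.

End SpecialLinearGroup.

Arguments phi : clear implicits.

(* Rep_K(G): every finite-dimensional space is taken in the form K^n (column  *)
(* vectors), with the Kronecker product as tensor product. A morphism X -> Y  *)
(* is a matrix acting on the left, so that composition is g *m f.             *)
Section Representations.
Variables (K : fieldType) (G : kgroup K).

Record rep := Rep {
  rdim : nat;
  ract : forall R : comAlgType K, G R -> 'M[R]_rdim;
  ract1 : forall R : comAlgType K, ract (gone : G R) = 1%:M;
  ractM : forall (R : comAlgType K) (x y : G R),
    ract (gmul x y) = ract x *m ract y;
  ract_nat : forall (R S : comAlgType K) (f : {lrmorphism R -> S}) (x : G R),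
    ract (kmap G f x) = map_mx f (ract x)
}.

Definition extmx (R : comAlgType K) m n (M : 'M[K]_(m, n)) : 'M[R]_(m, n) :=
  map_mx (in_alg R) M.

Definition is_hom (X Y : rep) (f : 'M[K]_(rdim Y, rdim X)) : Prop :=
  forall (R : comAlgType K) (x : G R),
    ract Y x *m extmx R f = extmx R f *m ract X x.
Arguments is_hom : clear implicits.

Definition is_iso (X Y : rep) (f : 'M[K]_(rdim Y, rdim X)) : Prop :=
  is_hom X Y f /\ exists g : 'M[K]_(rdim X, rdim Y),
    [/\ is_hom Y X g, g *m f = 1%:M & f *m g = 1%:M].
Arguments is_iso : clear implicits.

Definition rad (X Y : rep) (f : 'M[K]_(rdim Y, rdim X)) : Prop :=
  is_hom X Y f /\ forall g : 'M[K]_(rdim X, rdim Y), is_hom Y X g ->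
    is_iso X X (1%:M - g *m f).
Arguments rad : clear implicits.

(* The quotient category Rep_K(G)/rad has the same objects and morphisms as   *)
(* Rep_K(G), but eqbar as equality of morphisms; the projection pi is the     *)
(* identity on objects and on representatives of morphisms.                   *)
Definition eqbar (X Y : rep) (f g : 'M[K]_(rdim Y, rdim X)) : Prop :=
  rad X Y (f - g).
Arguments eqbar : clear implicits.

Lemma tens1mx (R : comAlgType K) m n :
  (1%:M : 'M[R]_m) *t (1%:M : 'M[R]_n) = 1%:M.
Proof.
apply/matrixP => i j.
case: (mxtens_indexP i) => a b; case: (mxtens_indexP j) => c d.
rewrite tensmxE !mxE -natrM mulnb; congr (_ %:R); congr nat_of_bool.
rewrite (can_eq (@mxtens_indexK _ _)).
by [].
Qed.

Section Tensor.
Variables X Y : rep.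

Definition tens_act (R : comAlgType K) (x : G R) :
  'M[R]_(rdim X * rdim Y) := ract X x *t ract Y x.
Lemma tens_act1 (R : comAlgType K) : tens_act (gone : G R) = 1%:M.
Proof. by rewrite /tens_act !ract1 tens1mx. Qed.
Lemma tens_actM (R : comAlgType K) (x y : G R) :
  tens_act (gmul x y) = tens_act x *m tens_act y.
Proof. by rewrite /tens_act !ractM tensmx_mul. Qed.
Lemma tens_act_nat (R S : comAlgType K) (f : {lrmorphism R -> S}) (x : G R) :
  tens_act (kmap G f x) = map_mx f (tens_act x).
Proof. by rewrite /tens_act !ract_nat map_mxT. Qed.

Definition rtens : rep := Rep tens_act1 tens_actM tens_act_nat.
End Tensor.

Definition unit_act (R : comAlgType K) (x : G R) : 'M[R]_1 := 1%:M.
Lemma unit_actM (R : comAlgType K) (x y : G R) :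
  unit_act (gmul x y) = unit_act x *m unit_act y.
Proof. by rewrite /unit_act mulmx1. Qed.
Lemma unit_act_nat (R S : comAlgType K) (f : {lrmorphism R -> S}) (x : G R) :
  unit_act (kmap G f x) = map_mx f (unit_act x).
Proof. by rewrite /unit_act map_mx1. Qed.

Definition runit : rep := Rep (fun _ => erefl) unit_actM unit_act_nat.

(* mxtens_index is the lexicographic numbering of the product basis, for      *)
(* which the associativity and unit constraints have identity matrices.       *)
Definition rassoc (X Y Z : rep) :
  'M[K]_(rdim (rtens X (rtens Y Z)), rdim (rtens (rtens X Y) Z)) :=
  castmx (esym (mulnA _ _ _), erefl) 1%:M.
Definition runitl (X : rep) : 'M[K]_(rdim X, rdim (rtens runit X)) :=
  castmx (mul1n _, erefl) 1%:M.
Definition runitr (X : rep) : 'M[K]_(rdim X, rdim (rtens X runit)) :=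
  castmx (muln1 _, erefl) 1%:M.
Definition rswap (X Y : rep) :
  'M[K]_(rdim (rtens Y X), rdim (rtens X Y)) :=
  \matrix_(i, j) (mxtens_unindex i == ((mxtens_unindex j).2,
                                       (mxtens_unindex j).1))%:R.

(* A monoidal section s : Rep_K(G)/rad -> Rep_K(G) of the projection pi. As   *)
(* pi is the identity on objects, so is s; sec X Y is the action of s on      *)
(* morphisms and only its values on morphisms X -> Y matter. The structural   *)
(* isomorphisms are mu : s X (x) s Y -> s (X (x) Y) and eps : 1 -> s 1. The   *)
(* last three fields say that pi o s is the identity as a monoidal functor.   *)
(* Compatibility with the symmetries (sec_sym) is required, as it is what     *)
(* makes omega_G o s a fibre functor. It is not implied by the other fields:  *)
(* for G = Ga, V the standard representation on K^2 and c in K, deforming the *)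
(* invariant e1(x)e2 - e2(x)e1 of V(x)V to e1(x)e2 - e2(x)e1 + c e1(x)e1      *)
(* defines a nonsymmetric section (Jordanian deformation of Rep SL_2) if c is *)
(* nonzero, whose group of monoidal automorphisms is not SL_2.                *)
Unset Implicit Arguments.
Record monoidal_section := MonoidalSection {
  sec : forall X Y : rep, 'M[K]_(rdim Y, rdim X) -> 'M[K]_(rdim Y, rdim X);
  sec_hom : forall (X Y : rep) (f : 'M[K]_(rdim Y, rdim X)),
    is_hom X Y f -> is_hom X Y (sec X Y f);
  sec_eqbar : forall (X Y : rep) (f g : 'M[K]_(rdim Y, rdim X)),
    is_hom X Y f -> is_hom X Y g -> eqbar X Y f g -> sec X Y f = sec X Y g;
  sec_linear : forall (X Y : rep) (a : K) (f g : 'M[K]_(rdim Y, rdim X)),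
    is_hom X Y f -> is_hom X Y g ->
    sec X Y (a *: f + g) = a *: sec X Y f + sec X Y g;
  sec_id : forall X : rep, sec X X 1%:M = 1%:M;
  sec_comp : forall (X Y Z : rep) (f : 'M[K]_(rdim Y, rdim X))
      (g : 'M[K]_(rdim Z, rdim Y)),
    is_hom X Y f -> is_hom Y Z g -> sec X Z (g *m f) = sec Y Z g *m sec X Y f;
  mu : forall X Y : rep, 'M[K]_(rdim (rtens X Y), rdim (rtens X Y));
  mu_iso : forall X Y : rep, is_iso (rtens X Y) (rtens X Y) (mu X Y);
  mu_nat : forall (X X' Y Y' : rep) (f : 'M[K]_(rdim X', rdim X))
      (g : 'M[K]_(rdim Y', rdim Y)),
    is_hom X X' f -> is_hom Y Y' g ->
    mu X' Y' *m (sec X X' f *t sec Y Y' g) =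
    sec (rtens X Y) (rtens X' Y') (f *t g) *m mu X Y;
  eps : 'M[K]_(rdim runit, rdim runit);
  eps_iso : is_iso runit runit eps;
  sec_assoc : forall X Y Z : rep,
    sec (rtens (rtens X Y) Z) (rtens X (rtens Y Z)) (rassoc X Y Z)
      *m mu (rtens X Y) Z *m (mu X Y *t 1%:M) =
    mu X (rtens Y Z) *m (1%:M *t mu Y Z) *m rassoc X Y Z;
  sec_unitl : forall X : rep,
    sec (rtens runit X) X (runitl X) *m mu runit X *m (eps *t 1%:M)
    = runitl X;
  sec_unitr : forall X : rep,
    sec (rtens X runit) X (runitr X) *m mu X runit *m (1%:M *t eps)
    = runitr X;
  sec_sym : forall X Y : rep,
    sec (rtens X Y) (rtens Y X) (rswap X Y) *m mu X Y = mu Y X *m rswap X Y;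
  sec_proj : forall (X Y : rep) (f : 'M[K]_(rdim Y, rdim X)),
    is_hom X Y f -> eqbar X Y (sec X Y f) f;
  mu_proj : forall X Y : rep, eqbar (rtens X Y) (rtens X Y) (mu X Y) 1%:M;
  eps_proj : eqbar runit runit eps 1%:M
}.
Set Implicit Arguments.

End Representations.

Arguments rdim {K G} _.
Arguments ract {K G} _ {R} x.
Arguments extmx {K} R {m n} M.
Arguments is_hom {K G} X Y f.
Arguments is_iso {K G} X Y f.
Arguments rad {K G} X Y f.
Arguments eqbar {K G} X Y f g.
Arguments runit {K G}.
Arguments monoidal_section {K} G.
Arguments sec {K G} _ X Y f.
Arguments mu {K G} _ X Y.
Arguments eps {K G} _.
Arguments sec_hom {K G} _ {X Y f} _.
Arguments sec_eqbar {K G} _ {X Y f g} _ _ _.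
Arguments sec_linear {K G} _ {X Y} a {f g} _ _.
Arguments sec_id {K G} _ X.
Arguments sec_comp {K G} _ {X Y Z f g} _ _.
Arguments mu_iso {K G} _ X Y.
Arguments mu_nat {K G} _ {X X' Y Y' f g} _ _.
Arguments eps_iso {K G} _.
Arguments sec_assoc {K G} _ X Y Z.
Arguments sec_unitl {K G} _ X.
Arguments sec_unitr {K G} _ X.
Arguments sec_sym {K G} _ X Y.
Arguments sec_proj {K G} _ {X Y f} _.
Arguments mu_proj {K G} _ X Y.
Arguments eps_proj {K G} _.

(* Groups of families of invertible matrices, with pointwise operations.      *)
Section MatrixFamilies.
Variables (I : Type) (d : I -> nat) (R : comPzRingType).
Implicit Types g h : forall i, 'M[R]_(d i).

Definition mxfam_inverse g h : Prop :=
  forall i, g i *m h i = 1%:M /\ h i *m g i = 1%:M.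

Record mxfam_closed (P : (forall i, 'M[R]_(d i)) -> Prop) : Prop := {
  mxfam_closed1 : P (fun i => 1%:M);
  mxfam_closedM : forall g h, P g -> P h -> P (fun i => g i *m h i);
  mxfam_closedV : forall g, P g -> exists h, P h /\ mxfam_inverse g h
}.

Variables (P : (forall i, 'M[R]_(d i)) -> Prop) (Pc : mxfam_closed P).

Definition mxfam_car : Type := {g : forall i, 'M[R]_(d i) | P g}.

Lemma mxfam_eqP (g h : mxfam_car) : (forall i, sval g i = sval h i) -> g = h.
Proof. by move=> gh; apply/sig_eqP/functional_extensionality_dep. Qed.

Definition mxfam_one : mxfam_car := exist _ _ (mxfam_closed1 Pc).
Definition mxfam_mul (g h : mxfam_car) : mxfam_car :=
  exist _ _ (mxfam_closedM Pc (svalP g) (svalP h)).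

Lemma mxfam_mulA (g h k : mxfam_car) :
  mxfam_mul g (mxfam_mul h k) = mxfam_mul (mxfam_mul g h) k.
Proof. by apply: mxfam_eqP => i; apply: mulmxA. Qed.
Lemma mxfam_mul1x (g : mxfam_car) : mxfam_mul mxfam_one g = g.
Proof. by apply: mxfam_eqP => i; apply: mul1mx. Qed.
Lemma mxfam_mulx1 (g : mxfam_car) : mxfam_mul g mxfam_one = g.
Proof. by apply: mxfam_eqP => i; apply: mulmx1. Qed.
Lemma mxfam_mulV (g : mxfam_car) :
  exists h : mxfam_car, mxfam_mul g h = mxfam_one /\ mxfam_mul h g = mxfam_one.
Proof.
have [h [Ph gh]] := mxfam_closedV Pc (svalP g).
by exists (exist _ h Ph); split; apply: mxfam_eqP => i; case: (gh i).
Qed.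

Definition mxfam : group :=
  Group mxfam_mulA mxfam_mul1x mxfam_mulx1 mxfam_mulV.
End MatrixFamilies.

(* A subfunctor of families of matrices, closed under the group operations    *)
(* and under base change, is a K-group.                                       *)
Section MatrixFamilyGroup.
Variables (K : fieldType) (I : Type) (d : I -> nat).
Variable P : forall R : comAlgType K, (forall i, 'M[R]_(d i)) -> Prop.
Hypothesis Pc : forall R : comAlgType K, mxfam_closed (@P R).
Hypothesis Pmap : forall (R S : comAlgType K) (f : {lrmorphism R -> S}) g,
  P g -> P (fun i => map_mx f (g i)).

Definition famgrp_map (R S : comAlgType K) (f : {lrmorphism R -> S})
  (g : mxfam (Pc R)) : mxfam (Pc S) := exist _ _ (Pmap f (svalP g)).

Lemma famgrp_mapM (R S : comAlgType K) (f : {lrmorphism R -> S})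
  (g h : mxfam (Pc R)) :
  famgrp_map f (gmul g h) = gmul (famgrp_map f g) (famgrp_map f h).
Proof. by apply: mxfam_eqP => i; apply: map_mxM. Qed.
Lemma famgrp_map_id (R : comAlgType K) (g : mxfam (Pc R)) :
  famgrp_map (idfun : {lrmorphism R -> R}) g = g.
Proof. by apply: mxfam_eqP => i; apply: map_mx_id. Qed.
Lemma famgrp_map_comp (R S T : comAlgType K) (f : {lrmorphism R -> S})
  (h : {lrmorphism S -> T}) (g : mxfam (Pc R)) :
  famgrp_map (h \o f : {lrmorphism R -> T}) g = famgrp_map h (famgrp_map f g).
Proof.
by apply: mxfam_eqP => i; apply/matrixP => a b; rewrite !mxE.
Qed.

Definition famgrp : kgroup K := @KGroup K (fun R => mxfam (Pc R))
  famgrp_map famgrp_mapM famgrp_map_id famgrp_map_comp.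
End MatrixFamilyGroup.

Section SectionGroups.
Variables (K : fieldType) (G : kgroup K) (s : monoidal_section G).

(* g is a monoidal endomorphism, over R, of omega_s = omega_G o s. Morphisms  *)
(* of the quotient category are represented by morphisms f of Rep_K(G).       *)
Definition tens_end (R : comAlgType K) (g : forall X : rep G, 'M[R]_(rdim X)) :
    Prop :=
  [/\ forall X Y (f : 'M[K]_(rdim Y, rdim X)), is_hom X Y f ->
        g Y *m extmx R (sec s X Y f) = extmx R (sec s X Y f) *m g X,
      forall X Y, g (rtens X Y) *m extmx R (mu s X Y) =
                  extmx R (mu s X Y) *m (g X *t g Y)
    & g runit *m extmx R (eps s) = extmx R (eps s)].

Definition tens_aut (R : comAlgType K) (g : forall X : rep G, 'M[R]_(rdim X)) :
    Prop :=
  tens_end g /\ exists h, mxfam_inverse g h.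

(* The image of R (x) P in 'M[R]_(m, n), for P a subspace of 'M[K]_(m, n).    *)
Inductive ext_span (R : comAlgType K) m n (P : 'M[K]_(m, n) -> Prop) :
    'M[R]_(m, n) -> Prop :=
  | ext_span0 : ext_span P 0
  | ext_spanD (a : R) (f : 'M[K]_(m, n)) (M : 'M[R]_(m, n)) :
      P f -> ext_span P M -> ext_span P (a *: extmx R f + M).

(* g is a monoidal automorphism of s over R, i.e. of the extension of s to    *)
(* the categories whose morphisms are R (x) Hom, and g projects to the        *)
(* identity in the quotient category.                                         *)
Definition unip_aut (R : comAlgType K) (g : forall X : rep G, 'M[R]_(rdim X)) :
    Prop :=
  [/\ tens_end g,
      forall X, ext_span (is_hom X X) (g X),
      exists h, (forall X, ext_span (is_hom X X) (h X)) /\ mxfam_inverse g h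
    & forall X, ext_span (rad X X) (g X - 1%:M)].

Lemma extmxM (R : comAlgType K) m n p (A : 'M[K]_(m, n)) (B : 'M[K]_(n, p)) :
  extmx R (A *m B) = extmx R A *m extmx R B.
Proof. exact: map_mxM. Qed.

Lemma extmx_map (R S : comAlgType K) (f : {lrmorphism R -> S}) m n
  (A : 'M[K]_(m, n)) : map_mx f (extmx R A) = extmx S A.
Proof. by apply/matrixP => i j; rewrite !mxE linearZ /= rmorph1. Qed.

Lemma tens_end1 (R : comAlgType K) :
  tens_end (fun X : rep G => 1%:M : 'M[R]_(rdim X)).
Proof.
split=> [X Y f _|X Y|]; rewrite ?mul1mx ?mulmx1 //.
by rewrite tens1mx mulmx1.
Qed.

Lemma tens_endM (R : comAlgType K) (g h : forall X : rep G, 'M[R]_(rdim X)) :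
  tens_end g -> tens_end h -> tens_end (fun X => g X *m h X).
Proof.
move=> [gn gt gu] [hn ht hu]; split=> [X Y f ff|X Y|].
- by rewrite -mulmxA hn // mulmxA gn // mulmxA.
- by rewrite -mulmxA ht mulmxA gt -mulmxA tensmx_mul.
- by rewrite -mulmxA hu gu.
Qed.

Lemma tens_endV (R : comAlgType K) (g h : forall X : rep G, 'M[R]_(rdim X)) :
  tens_end g -> mxfam_inverse g h -> tens_end h.
Proof.
move=> [gn gt gu] gh.
have gV X : g X *m h X = 1%:M by case: (gh X).
have Vg X : h X *m g X = 1%:M by case: (gh X).
split=> [X Y f ff|X Y|].
- rewrite -[LHS]mulmx1 -(gV X) mulmxA -(mulmxA _ _ (g X)) -gn //.
  by rewrite mulmxA Vg mul1mx.
- rewrite -[LHS]mulmx1 -(tens1mx R) -(gV X) -(gV Y) -tensmx_mul mulmxA.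
  by rewrite -(mulmxA _ _ (g X *t g Y)) -gt !mulmxA Vg mul1mx.
- by rewrite -{1}gu mulmxA Vg mul1mx.
Qed.

Lemma tens_end_map (R S : comAlgType K) (f : {lrmorphism R -> S})
    (g : forall X : rep G, 'M[R]_(rdim X)) :
  tens_end g -> tens_end (fun X => map_mx f (g X)).
Proof.
move=> [gn gt gu]; split=> [X Y a aa|X Y|].
- by rewrite -!(extmx_map f) -!map_mxM gn.
- by rewrite -!(extmx_map f) -map_mxT -!map_mxM gt.
- by rewrite -!(extmx_map f) -!map_mxM gu.
Qed.

Lemma mxfam_inverse_map (R S : comAlgType K) (f : {lrmorphism R -> S})
    (g h : forall X : rep G, 'M[R]_(rdim X)) :
  mxfam_inverse g h ->
  mxfam_inverse (fun X => map_mx f (g X)) (fun X => map_mx f (h X)).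
Proof. by move=> gh X; rewrite -!map_mxM !(proj1 (gh X), proj2 (gh X)) map_mx1. Qed.

Lemma mxfam_inverseM (R : comAlgType K)
    (g h g' h' : forall X : rep G, 'M[R]_(rdim X)) :
  mxfam_inverse g h -> mxfam_inverse g' h' ->
  mxfam_inverse (fun X => g X *m g' X) (fun X => h' X *m h X).
Proof.
move=> gh gh' X; split.
  by rewrite mulmxA -(mulmxA _ (g' X)) (proj1 (gh' X)) mulmx1 (proj1 (gh X)).
by rewrite mulmxA -(mulmxA _ (h X)) (proj2 (gh X)) mulmx1 (proj2 (gh' X)).
Qed.

Lemma tens_aut_closed (R : comAlgType K) : mxfam_closed (@tens_aut R).
Proof.
split.
- by split; [exact: tens_end1 | exists (fun X => 1%:M) => X; rewrite mulmx1].
- move=> g g' [ge [h gh]] [ge' [h' gh']]; split; first exact: tens_endM.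
  by exists (fun X => h' X *m h X); apply: mxfam_inverseM.
- move=> g [ge [h gh]]; exists h; split=> //; split; first exact: tens_endV gh.
  by exists g => X; case: (gh X).
Qed.

Lemma tens_aut_map (R S : comAlgType K) (f : {lrmorphism R -> S})
    (g : forall X : rep G, 'M[R]_(rdim X)) :
  tens_aut g -> tens_aut (fun X => map_mx f (g X)).
Proof.
move=> [ge [h gh]]; split; first exact: tens_end_map.
by exists (fun X => map_mx f (h X)); apply: mxfam_inverse_map.
Qed.

(* The pro-reductive envelope G_s = Aut^(x)(omega_s). *)
Definition pRed : kgroup K := famgrp tens_aut_closed tens_aut_map.

Lemma ext_span_incl (R : comAlgType K) m n (P Q : 'M[K]_(m, n) -> Prop)
  (M : 'M[R]_(m, n)) : (forall f, P f -> Q f) -> ext_span P M -> ext_span Q M.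
Proof.
by move=> PQ; elim=> [|a f N /PQ Qf _ IH]; [apply: ext_span0 | apply: ext_spanD].
Qed.

Lemma ext_span_add (R : comAlgType K) m n (P : 'M[K]_(m, n) -> Prop)
  (M N : 'M[R]_(m, n)) : ext_span P M -> ext_span P N -> ext_span P (M + N).
Proof.
move=> PM PN; elim: PM => [|a f M' Pf _ IH]; first by rewrite add0r.
by rewrite -addrA; apply: ext_spanD.
Qed.

Lemma ext_span_scale (R : comAlgType K) m n (P : 'M[K]_(m, n) -> Prop)
  (a : R) (M : 'M[R]_(m, n)) : ext_span P M -> ext_span P (a *: M).
Proof.
elim=> [|b f M' Pf _ IH]; first by rewrite scaler0; apply: ext_span0.
by rewrite scalerDr scalerA; apply: ext_spanD.
Qed.

Lemma ext_span_mul (R : comAlgType K) m n p (P : 'M[K]_(m, n) -> Prop)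
    (Q : 'M[K]_(n, p) -> Prop) (S : 'M[K]_(m, p) -> Prop)
    (M : 'M[R]_(m, n)) (N : 'M[R]_(n, p)) :
  (forall f g, P f -> Q g -> S (f *m g)) ->
  ext_span P M -> ext_span Q N -> ext_span S (M *m N).
Proof.
move=> PQS PM QN; elim: PM => [|a f M' Pf _ IH].
  by rewrite mul0mx; apply: ext_span0.
rewrite mulmxDl; apply: ext_span_add IH.
rewrite -scalemxAl; apply: ext_span_scale.
elim: QN => [|b g N' Qg _ IH]; first by rewrite mulmx0; apply: ext_span0.
rewrite mulmxDr -scalemxAr -extmxM.
by apply: ext_spanD IH; apply: PQS.
Qed.

Lemma ext_span_map (R S : comAlgType K) (f : {lrmorphism R -> S}) m n
  (P : 'M[K]_(m, n) -> Prop) (M : 'M[R]_(m, n)) :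
  ext_span P M -> ext_span P (map_mx f M).
Proof.
elim=> [|a g M' Pg _ IH]; first by rewrite map_mx0; apply: ext_span0.
by rewrite map_mxD map_mxZ extmx_map; apply: ext_spanD.
Qed.

Lemma is_homM (X Y Z : rep G) (f : 'M[K]_(rdim Y, rdim X))
  (g : 'M[K]_(rdim Z, rdim Y)) :
  is_hom Y Z g -> is_hom X Y f -> is_hom X Z (g *m f).
Proof. by move=> gh fh R x; rewrite extmxM mulmxA gh -mulmxA fh mulmxA. Qed.

Lemma is_hom1 (X : rep G) : is_hom X X 1%:M.
Proof. by move=> R x; rewrite /extmx map_mx1 mulmx1 mul1mx. Qed.

Lemma is_homN (X Y : rep G) (f : 'M[K]_(rdim Y, rdim X)) :
  is_hom X Y f -> is_hom X Y (- f).
Proof. by move=> fh R x; rewrite /extmx map_mxN mulmxN mulNmx fh. Qed.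

Lemma rad_mull (X : rep G) (f g : 'M[K]_(rdim X, rdim X)) :
  is_hom X X g -> rad X X f -> rad X X (g *m f).
Proof.
move=> gh [fh fr]; split; first exact: is_homM.
by move=> k kh; rewrite mulmxA; apply: fr; apply: is_homM.
Qed.

Lemma ext_span1 (R : comAlgType K) (X : rep G) :
  ext_span (is_hom X X) (1%:M : 'M[R]_(rdim X)).
Proof.
rewrite -[1%:M]addr0 -[1%:M]scale1r -(map_mx1 (in_alg R)).
by apply: ext_spanD; [apply: is_hom1 | apply: ext_span0].
Qed.

Lemma ext_spanN (R : comAlgType K) m n (P : 'M[K]_(m, n) -> Prop)
  (M : 'M[R]_(m, n)) : ext_span P M -> ext_span P (- M).
Proof. by move=> PM; rewrite -scaleN1r; apply: ext_span_scale. Qed.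

Lemma unip_aut_closed (R : comAlgType K) : mxfam_closed (@unip_aut R).
Proof.
split.
- split; [exact: tens_end1 | by move=> X; apply: ext_span1 | | ].
    exists (fun X => 1%:M); split=> X; [exact: ext_span1 | by rewrite mulmx1].
  by move=> X; rewrite subrr; apply: ext_span0.
- move=> g g' [ge gs [h [hs gh]] gr] [ge' gs' [h' [hs' gh']] gr']; split.
  + exact: tens_endM.
  + by move=> X; apply: ext_span_mul (gs X) (gs' X) => f k; apply: is_homM.
  + exists (fun X => h' X *m h X); split; last exact: mxfam_inverseM.
    by move=> X; apply: ext_span_mul (hs' X) (hs X) => f k; apply: is_homM.
  + move=> X; have -> : g X *m g' X - 1%:M = g X *m (g' X - 1%:M) + (g X - 1%:M).
      by rewrite mulmxBr mulmx1 addrA subrK.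
    apply: ext_span_add (gr X); apply: ext_span_mul (gs X) (gr' X) => f k.
    exact: rad_mull.
- move=> g [ge gs [h [hs gh]] gr]; exists h; split=> //; split=> //.
  + exact: tens_endV gh.
  + by exists g; split=> // X; case: (gh X).
  + move=> X; have -> : h X - 1%:M = h X *m - (g X - 1%:M).
      by rewrite mulmxN mulmxBr mulmx1 (proj2 (gh X)) opprB.
    apply: ext_span_mul (hs X) (ext_spanN (gr X)) => f k.
    exact: rad_mull.
Qed.

Lemma unip_aut_map (R S : comAlgType K) (f : {lrmorphism R -> S})
    (g : forall X : rep G, 'M[R]_(rdim X)) :
  unip_aut g -> unip_aut (fun X => map_mx f (g X)).
Proof.
move=> [ge gs [h [hs gh]] gr]; split.
- exact: tens_end_map.
- by move=> X; apply: ext_span_map.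
- exists (fun X => map_mx f (h X)); split; last exact: mxfam_inverse_map.
  by move=> X; apply: ext_span_map.
- by move=> X; rewrite -(map_mx1 f) -map_mxB; apply: ext_span_map.
Qed.

(* The unipotent complement U_s; omega_G being faithful, its elements are     *)
(* written as elements of pRed.                                               *)
Definition pU : kgroup K := famgrp unip_aut_closed unip_aut_map.

Lemma ract_tens_aut (R : comAlgType K) (x : G R) :
  tens_aut (fun X : rep G => ract X x).
Proof.
split; last first.
  have [y [xy yx]] := gmulV x.
  by exists (fun X => ract X y) => X; rewrite -!ractM xy yx ract1.
split=> [X Y f fh|X Y|].
- exact: sec_hom.
- by case: (mu_iso s X Y) => + _; apply.
- by rewrite /= mul1mx.
Qed.

Definition sharp_fun (R : comAlgType K) (x : G R) : pRed R :=
  exist _ _ (ract_tens_aut x).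

Lemma sharpM (R : comAlgType K) (x y : G R) :
  sharp_fun (gmul x y) = gmul (sharp_fun x) (sharp_fun y).
Proof. by apply: mxfam_eqP => X; apply: ractM. Qed.
Lemma sharp_nat (R S : comAlgType K) (f : {lrmorphism R -> S}) (x : G R) :
  sharp_fun (kmap G f x) = kmap pRed f (sharp_fun x).
Proof. by apply: mxfam_eqP => X; apply: ract_nat. Qed.

Definition sharp : khom G pRed := @KHom K _ _ sharp_fun sharpM sharp_nat.

End SectionGroups.

(* Main.v *)
From HB Require Import structures.
From mathcomp Require Import all_boot all_order all_algebra.
From mathcomp Require Import boolp mxtens.
From mathcomp Require Import ring zify.
Require Import Defs.

Set Implicit Arguments.
Unset Strict Implicit.
Unset Printing Implicit Defensive.

Import GRing.Theory.
Local Open Scope ring_scope.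

(** Write V for the plane K^2 on which Ga acts through phi. In characteristic 0
a representation X of Ga is the same thing as a nilpotent matrix infgen X: the
action is exp(a infgen X) (ract_exp), and morphisms are the matrices that
commute with the generators (is_homP). By the Jordan normal form every
representation is a sum of symmetric powers Sym^n V (sum_sym1), a morphism
Sym^m V -> Sym^n V is in the radical if m <> n, and is a scalar modulo the
radical if m = n (sym_hom00_rad). So the section s sends morphisms between the
Sym^n V to 0 or to scalars, and Rep(Ga)/rad is Rep(SL2) in disguise.

A point of Aut(omega_s) is a family of matrices g X, and the isomorphism with
SL2 is the evaluation g |-> g V. Its three ingredients are as follows.

- det (g V) = 1 (tens_end_det). The determinant form V (x) V -> 1 is a morphism
of Ga-representations. Its image under s, read on V (x) V through mu, is again
antisymmetric because s is symmetric, hence is a multiple of the form; this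
multiple is not 0 since the form is split. As g preserves it, det (g V) = 1.

- g V determines g (tens_end_uniq), because Sym^(n+1) V is a direct summand of
V (x) Sym^n V and every representation is a sum of Sym^n V's.

- Every M with det M = 1 is some g V. On Sym^n V the matrix is built by
induction: Sym^(n+1) V is the image of an idempotent of V (x) Sym^n V,
proportional to polarization after multiplication, and one has to know that
this idempotent commutes with M (x) g (Sym^n V) (sl2_sym_equivariant). The
Clebsch-Gordan relation polar_pmulS expresses it through two maps delta, gamma
composed of the alternating form, its dual, and the multiplication and
polarization one degree lower; these are compatible with M, the former because
det M = 1 and the latter by induction. The family is then extended to all
representations by means of Jordan decompositions (extend_sl2_sym). Naturality
is Schur's lemma modulo the radical; compatibility with tensor products reduces
to V (x) Sym^n V, where it is the Clebsch-Gordan decomposition again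
(sl2_family_tens_end).

Since Ga acts on V through phi, this isomorphism carries s^sharp to phi. A point
of the unipotent complement acts on V by 1 plus an element of R (x) rad(V, V),
that is, by some phi(a); by uniqueness it is then the action of a. Conversely,
the actions of the points of Ga lie in the unipotent complement, because they
are polynomials in the nilpotent endomorphism infgen X, whose positive powers
are in the radical (ract_unip). *)

(** * Kronecker products and casts of the identity matrix *)

Lemma sum_tens (V : nmodType) m n (F : 'I_(m * n) -> V) :
  \sum_k F k = \sum_(i < m) \sum_(j < n) F (mxtens_index (i, j)).
Proof.
rewrite pair_big; apply: reindex => /=.
by exists (@mxtens_unindex m n) => [[i j]|k] _; rewrite (mxtens_indexK, mxtens_unindexK).
Qed.

Lemma sumn_delta m c (F : nat -> nat) :
  (\sum_(l < m) F l * (l == c :> nat))%N = (F c * (c < m))%N.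
Proof.
case: ltnP => cm; last first.
  by rewrite muln0 big1 // => l _; rewrite ltn_eqF ?muln0 // (leq_trans _ cm).
rewrite (bigD1 (Ordinal cm)) //= eqxx big1 ?addn0 // => i.
by rewrite -val_eqE /= => /negPf ->; rewrite muln0.
Qed.

Lemma tens_id (R : pzRingType) m n : (1%:M : 'M[R]_m) *t (1%:M : 'M[R]_n) = 1%:M.
Proof.
apply/matrixP => i j; case: (mxtens_indexP i) => a b; case: (mxtens_indexP j) => c d.
by rewrite tensmxE !mxE (can_eq (@mxtens_indexK _ _)) xpair_eqE -natrM mulnb.
Qed.

Lemma tensmxDl (R : pzRingType) m n p q (A B : 'M[R]_(m, n)) (C : 'M[R]_(p, q)) :
  (A + B) *t C = A *t C + B *t C.
Proof. by apply/matrixP => i j; rewrite !mxE mulrDl. Qed.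

Lemma tensmxDr (R : pzRingType) m n p q (A B : 'M[R]_(m, n)) (C : 'M[R]_(p, q)) :
  C *t (A + B) = C *t A + C *t B.
Proof. by apply/matrixP => i j; rewrite !mxE mulrDr. Qed.

(** The Kronecker product is associative up to casts, so the associativity
constraint has the identity matrix. *)
Lemma tensmxA (R : comPzRingType) m n p m' n' p'
    (A : 'M[R]_(m, m')) (B : 'M[R]_(n, n')) (C : 'M[R]_(p, p')) :
  castmx (esym (mulnA _ _ _), esym (mulnA _ _ _)) ((A *t B) *t C) = A *t (B *t C).
Proof.
apply/matrixP => i j.
case: (mxtens_indexP i) => i1 k; case: (mxtens_indexP k) => i2 i3 {i k}.
case: (mxtens_indexP j) => j1 k; case: (mxtens_indexP k) => j2 j3 {j k}.
rewrite castmxE /= !tensmxE mulrA -!tensmxE.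
by congr ((_ *t _ *t _) _ _); apply: val_inj; rewrite /= mulnA mulnDl addnA.
Qed.

Section TensEntries.
Variable R : comNzRingType.

Lemma mul_tens1E m p q r (A : 'M[R]_(m, p * q)) (B : 'M[R]_(p, r)) i u j :
  (A *m (B *t 1%:M)) i (mxtens_index (u, j)) =
  \sum_v A i (mxtens_index (v, j)) * B v u.
Proof.
rewrite mxE sum_tens; apply: eq_bigr => v _.
rewrite (bigD1 j) //= tensmxE mxE eqxx mulr1 big1 ?addr0 // => l /negPf lj.
by rewrite tensmxE mxE lj !mulr0.
Qed.

Lemma mul_1tensE m p q r (A : 'M[R]_(m, p * q)) (B : 'M[R]_(q, r)) i u j :
  (A *m (1%:M *t B)) i (mxtens_index (u, j)) =
  \sum_l A i (mxtens_index (u, l)) * B l j.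
Proof.
rewrite mxE sum_tens (bigD1 u) //= [X in _ + X]big1 ?addr0 => [|v /negPf vu].
  by apply: eq_bigr => l _; rewrite tensmxE mxE eqxx mul1r.
by apply: big1 => l _; rewrite tensmxE mxE vu mul0r mulr0.
Qed.

Lemma tens1_mulE m p q r (A : 'M[R]_(p * q, m)) (B : 'M[R]_(r, p)) i u j :
  ((B *t 1%:M) *m A) (mxtens_index (u, j)) i =
  \sum_v B u v * A (mxtens_index (v, j)) i.
Proof.
rewrite mxE sum_tens; apply: eq_bigr => v _.
rewrite (bigD1 j) //= tensmxE mxE eqxx mulr1 big1 ?addr0 // => l /negPf lj.
by rewrite tensmxE mxE eq_sym lj mulr0 mul0r.
Qed.

Lemma tens_mul1E m p q r (A : 'M[R]_(p * q, m)) (B : 'M[R]_(r, q)) i u j :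
  ((1%:M *t B) *m A) (mxtens_index (u, j)) i =
  \sum_l B j l * A (mxtens_index (u, l)) i.
Proof.
rewrite mxE sum_tens (bigD1 u) //= [X in _ + X]big1 ?addr0 => [|v /negPf vu].
  by apply: eq_bigr => l _; rewrite tensmxE mxE eqxx mul1r.
by apply: big1 => l _; rewrite tensmxE mxE eq_sym vu !mul0r.
Qed.

End TensEntries.

Section CastIdentity.
Variables (R : pzRingType) (m n : nat) (e : m = n).

Lemma castid_mul p (A : 'M[R]_(m, p)) : castmx (e, erefl) 1%:M *m A = castmx (e, erefl) A.
Proof. by case: n / e; rewrite !castmx_id mul1mx. Qed.

Lemma mul_castid p (A : 'M[R]_(p, n)) :
  A *m castmx (e, erefl) 1%:M = castmx (erefl, esym e) A.
Proof. by move: A; case: n / e => A; rewrite !castmx_id mulmx1. Qed.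

Lemma tr_castid : (castmx (e, erefl) (1%:M : 'M[R]_m))^T = castmx (esym e, erefl) 1%:M.
Proof. by case: n / e; rewrite !castmx_id trmx1. Qed.

Lemma castidK : (castmx (e, erefl) (1%:M : 'M[R]_m))^T *m castmx (e, erefl) 1%:M = 1%:M.
Proof. by case: n / e; rewrite !castmx_id trmx1 mulmx1. Qed.

Lemma castidVK : castmx (e, erefl) 1%:M *m (castmx (e, erefl) (1%:M : 'M[R]_m))^T = 1%:M.
Proof. by case: n / e; rewrite !castmx_id trmx1 mulmx1. Qed.
End CastIdentity.

Section ExtTheory.
Variables (K : fieldType) (R : comAlgType K).

Lemma extmx1 n : extmx R (1%:M : 'M[K]_n) = 1%:M.
Proof. exact: map_mx1. Qed.

Lemma extmxZ m n a (A : 'M[K]_(m, n)) : extmx R (a *: A) = a%:A *: extmx R A.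
Proof. by rewrite /extmx map_mxZ. Qed.

Lemma extmxD m n (A B : 'M[K]_(m, n)) : extmx R (A + B) = extmx R A + extmx R B.
Proof. exact: map_mxD. Qed.

Lemma extmx0 m n : extmx R (0 : 'M[K]_(m, n)) = 0.
Proof. exact: map_mx0. Qed.

Lemma extmxT m n p q (A : 'M[K]_(m, n)) (B : 'M[K]_(p, q)) :
  extmx R (A *t B) = extmx R A *t extmx R B.
Proof. exact: map_mxT. Qed.

Lemma extmx_inj_mulr m n p (A B : 'M[R]_(m, n)) (u : 'M[K]_(n, p)) v :
  u *m v = 1%:M -> A *m extmx R u = B *m extmx R u -> A = B.
Proof.
move=> uv /(congr1 (fun C => C *m extmx R v)).
by rewrite -!mulmxA -extmxM uv extmx1 !mulmx1.
Qed.
End ExtTheory.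

(** * Morphisms and constraints in the category of representations *)

Section Constraints.
Variables (K : fieldType) (G : kgroup K).
Implicit Types X Y Z : rep G.

Lemma is_homZ X Y a (f : 'M[K]_(rdim Y, rdim X)) : is_hom X Y f -> is_hom X Y (a *: f).
Proof.
by move=> fh R x; rewrite /extmx map_mxZ -scalemxAl -scalemxAr fh.
Qed.

Lemma is_homD X Y (f g : 'M[K]_(rdim Y, rdim X)) :
  is_hom X Y f -> is_hom X Y g -> is_hom X Y (f + g).
Proof. by move=> fh gh R x; rewrite /extmx map_mxD mulmxDr mulmxDl fh gh. Qed.

Lemma is_hom0 X Y : is_hom X Y 0.
Proof. by move=> R x; rewrite /extmx map_mx0 mulmx0 mul0mx. Qed.

(** Inverses of morphisms are morphisms, so that a representation map is an
isomorphism as soon as its matrix is invertible. *)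
Lemma is_hom_inv X Y (f : 'M[K]_(rdim Y, rdim X)) (g : 'M[K]_(rdim X, rdim Y)) :
  f *m g = 1%:M -> g *m f = 1%:M -> is_hom X Y f -> is_hom Y X g.
Proof.
move=> fg gf fh R x.
rewrite -[LHS]mul1mx -(map_mx1 (in_alg R)) -gf -/(extmx R _) extmxM.
by rewrite -mulmxA (mulmxA (extmx R f)) -fh -!mulmxA -extmxM fg /extmx map_mx1 mulmx1.
Qed.

Lemma is_hom_tens X X' Y Y' (f : 'M[K]_(rdim X', rdim X)) (g : 'M[K]_(rdim Y', rdim Y)) :
  is_hom X X' f -> is_hom Y Y' g -> is_hom (rtens X Y) (rtens X' Y') (f *t g).
Proof.
by move=> fh gh R x; rewrite /extmx map_mxT /= /tens_act !tensmx_mul -!/(extmx R _) fh gh.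
Qed.

Lemma rassoc_hom X Y Z : is_hom (rtens (rtens X Y) Z) (rtens X (rtens Y Z)) (rassoc X Y Z).
Proof.
move=> R x; rewrite /rassoc /extmx map_castmx map_mx1 castid_mul mul_castid /=.
rewrite /tens_act -tensmxA castmx_comp.
by congr (castmx _ _); congr pair; apply: nat_irrelevance.
Qed.

Lemma runitl_hom X : is_hom (rtens runit X) X (runitl X).
Proof.
move=> R x; rewrite /runitl /extmx map_castmx map_mx1 castid_mul mul_castid /=.
rewrite /tens_act /= /unit_act tens_scalar_mx castmx_comp scale1r.
by congr (castmx _ _); congr pair; apply: nat_irrelevance.
Qed.

Lemma runitr_hom X : is_hom (rtens X runit) X (runitr X).
Proof.
move=> R x; rewrite /runitr /extmx map_castmx map_mx1 castid_mul mul_castid /=.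
rewrite /tens_act /= /unit_act tens_mx_scalar castmx_comp scale1r.
by congr (castmx _ _); congr pair; apply: nat_irrelevance.
Qed.

Lemma runitl_inv X :
  runitl X *m (runitl X)^T = 1%:M /\ (runitl X)^T *m runitl X = 1%:M.
Proof. by split; [apply: castidVK | apply: castidK]. Qed.

Lemma rassoc_inv X Y Z :
  rassoc X Y Z *m (rassoc X Y Z)^T = 1%:M /\ (rassoc X Y Z)^T *m rassoc X Y Z = 1%:M.
Proof. by split; [apply: castidVK | apply: castidK]. Qed.

Section Swap.
Variables (S : comNzRingType) (f : {rmorphism K -> S}) (X Y : rep G).

Lemma mul_rswapE m (A : 'M[S]_(m, rdim Y * rdim X)) i u v :
  (A *m map_mx f (rswap X Y)) i (mxtens_index (u, v)) = A i (mxtens_index (v, u)).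
Proof.
rewrite mxE (bigD1 (mxtens_index (v, u))) //= !mxE !mxtens_indexK /= eqxx rmorph1 mulr1.
rewrite big1 ?addr0 // => k; case: (mxtens_indexP k) => a b.
rewrite (can_eq (@mxtens_indexK _ _)) => /negPf ab.
by rewrite !mxE !mxtens_indexK /= ab rmorph0 mulr0.
Qed.

Lemma rswap_mulE m (A : 'M[S]_(rdim X * rdim Y, m)) i u v :
  (map_mx f (rswap X Y) *m A) (mxtens_index (u, v)) i = A (mxtens_index (v, u)) i.
Proof.
rewrite mxE (bigD1 (mxtens_index (v, u))) //= !mxE !mxtens_indexK /= eqxx rmorph1 mul1r.
rewrite big1 ?addr0 // => k; case: (mxtens_indexP k) => a b.
rewrite (can_eq (@mxtens_indexK _ _)) => /negPf ab.
rewrite !mxE !mxtens_indexK /= xpair_eqE andbC [u == b]eq_sym [v == a]eq_sym.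
by rewrite xpair_eqE in ab; rewrite ab rmorph0 mul0r.
Qed.
End Swap.

Lemma rswap_hom X Y : is_hom (rtens X Y) (rtens Y X) (rswap X Y).
Proof.
move=> R x; apply/matrixP => i j.
case: (mxtens_indexP i) => a b; case: (mxtens_indexP j) => u v.
by rewrite mul_rswapE rswap_mulE /= /tens_act !tensmxE mulrC.
Qed.

Lemma rassoc_mulE X Y Z m (A : 'M[K]_(rdim X * rdim Y * rdim Z, m)) i u v w :
  (rassoc X Y Z *m A) (mxtens_index (u, mxtens_index (v, w))) i =
  A (mxtens_index (mxtens_index (u, v), w)) i.
Proof.
rewrite castid_mul castmxE; congr (A _ _); apply: val_inj => //=.
by rewrite mulnA mulnDl addnA.
Qed.

Lemma mul_rassocTE X Y Z m (A : 'M[K]_(m, rdim X * rdim Y * rdim Z)) i u v w :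
  (A *m (rassoc X Y Z)^T) i (mxtens_index (u, mxtens_index (v, w))) =
  A i (mxtens_index (mxtens_index (u, v), w)).
Proof.
rewrite tr_castid mul_castid castmxE; congr (A _ _); apply: val_inj => //=.
by rewrite mulnA mulnDl addnA.
Qed.
End Constraints.

(** * Representations of the additive group as nilpotent matrices *)

Section Evaluation.
Variables (K : fieldType) (R : comAlgType K) (a : R).

(** The morphism of K-algebras from K[t] to R that represents the point a of Ga;
redefined so that it carries the K-linear structure of R. *)
Definition evp (p : {poly K}) : R := horner_alg a p.

Lemma evp_linear : linear evp.
Proof. by move=> c p q; rewrite /evp linearP /= mulr_algl. Qed.

Lemma evp_monoid : monoid_morphism evp.
Proof. by split=> [|p q]; rewrite /evp (rmorph1, rmorphM). Qed.

HB.instance Definition _ := GRing.isLinear.Build K {poly K} R _ evp evp_linear.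
HB.instance Definition _ := GRing.isMonoidMorphism.Build {poly K} R evp evp_monoid.

Lemma evpX : evp 'X = a.
Proof. exact: horner_algX. Qed.

Lemma evpC c : evp c%:P = c%:A.
Proof. exact: horner_algC. Qed.

Lemma evpE n (p : {poly K}) : (size p <= n)%N -> evp p = \sum_(k < n) p`_k *: a ^+ k.
Proof.
move=> pn; rewrite -[p in LHS]coefK poly_def (big_ord_widen n (fun i => p`_i *: 'X^i)) //.
rewrite linear_sum big_mkcond; apply: eq_bigr => k _ /=.
case: ltnP => kp; first by rewrite linearZ /= rmorphXn /= evpX.
by rewrite nth_default // scale0r.
Qed.
End Evaluation.

Lemma evp_constE (K : fieldType) (b : K) (p : {poly K}) :
  evp (b%:P : {poly K}) p = p.[b]%:P.
Proof.
elim/poly_ind: p => [|p c IH]; first by rewrite linear0 horner0.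
rewrite linearD rmorphM /= IH evpX hornerMXaddC rmorphD rmorphM /=.
by rewrite evpC alg_polyC.
Qed.

Lemma evp_shiftE (K : fieldType) (b : K) (p : {poly K}) :
  evp ('X + b%:P : {poly K}) p = p \Po ('X + b%:P).
Proof.
elim/poly_ind: p => [|p c IH]; first by rewrite linear0 comp_poly0.
rewrite linearD rmorphM /= IH evpX comp_poly_MXaddC.
by rewrite evpC alg_polyC.
Qed.

Section CharZero.
Variable K : fieldType.
Hypothesis charK0 : [pchar K]%R =i pred0.

Lemma natK_eq0 n : ((n%:R : K) == 0) = (n == 0%N).
Proof. by have /pcharf0P -> := charK0. Qed.

Lemma factK_neq0 n : (n`!%:R : K) != 0.
Proof. by rewrite natK_eq0 -lt0n fact_gt0. Qed.

(** K is infinite: the values at natural numbers are enough. *)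
Lemma poly_horner_eq (p q : {poly K}) : (forall b, p.[b] = q.[b]) -> p = q.
Proof.
move=> pq; apply/eqP; rewrite -subr_eq0; apply/negPn/negP => nz.
set r := p - q in nz; pose s := [seq n%:R : K | n <- iota 0 (size r)].
suff: (size s < size r)%N by rewrite size_map size_iota ltnn.
apply: max_poly_roots => //.
  by apply/allP => b _; rewrite /root hornerD hornerN pq subrr.
rewrite map_inj_uniq ?iota_uniq // => m n /eqP.
wlog le : m n / (m <= n)%N.
  by move=> W; case: (leqP m n) => [/W//|/ltnW/W {}W]; rewrite eq_sym => /W.
by rewrite eq_sym -subr_eq0 -natrB // natK_eq0 subn_eq0 => nm; apply/anti_leq/andP.
Qed.

Implicit Types X Y Z : rep (Ga K).

(** The action of the universal point t of Ga over K[t]. *)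
Definition univ_act X : 'M[{poly K}]_(rdim X) :=
  ract X ('X : Ga K {poly K}).

Definition coefmx m n k (A : 'M[{poly K}]_(m, n)) := map_mx (coefp k) A.

(** The derivative of the action at the origin. *)
Definition infgen X : 'M[K]_(rdim X) := coefmx 1 (univ_act X).

Lemma ract_univ X (R : comAlgType K) (a : Ga K R) :
  ract X a = map_mx (evp (a : R)) (univ_act X).
Proof.
by rewrite -(ract_nat _ (evp (a : R) : {lrmorphism {poly K} -> R})) /= /ga_map /= evpX.
Qed.

Lemma univ_act_coef0 X : coefmx 0 (univ_act X) = 1%:M.
Proof.
apply/matrixP => i j; have := ract1 X ({poly K} : comAlgType K).
rewrite ract_univ => /matrixP/(_ i j); rewrite !mxE /= -[0]/(0%:P) evp_constE.
rewrite horner_coef0 -polyC_natr => /polyC_inj; exact.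
Qed.

(** Translation by b in K turns the action M into M(t + b) = M(t) M(b). Taking
the derivative at t = 0 for all b gives M' = infgen X * M. *)
Lemma univ_act_coefS X k :
  (k.+1%:R : K) *: coefmx k.+1 (univ_act X) = infgen X *m coefmx k (univ_act X).
Proof.
have addE (b : K) : map_mx (comp_poly ('X + b%:P)) (univ_act X) =
    univ_act X *m map_mx (fun p => p.[b]%:P) (univ_act X).
  have := ractM X ('X : Ga K {poly K}) (b%:P : Ga K {poly K}).
  rewrite (ract_univ X (b%:P : Ga K {poly K})) /= -/(univ_act X).
  set u : Ga K {poly K} := 'X + b%:P => /= h.
  have -> : map_mx (comp_poly ('X + b%:P)) (univ_act X) = ract X u.
    by rewrite ract_univ; apply/matrixP => i j; rewrite !mxE evp_shiftE.
  rewrite {}h; congr (_ *m _).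
  by apply/matrixP => i j; rewrite !mxE evp_constE.
apply/matrixP => i j.
have E : (univ_act X i j)^`() = \sum_l infgen X i l *: univ_act X l j.
  apply: poly_horner_eq => b.
  have /matrixP/(_ i j)/(congr1 (fun p => p^`().[0])) := addE b.
  rewrite !mxE deriv_comp !derivE addr0 mulr1 horner_comp !hornerE => ->.
  rewrite linear_sum /= !horner_sum; apply: eq_bigr => l _.
  by rewrite !mxE !derivE !hornerE horner_coef0 coef_deriv.
have := congr1 (fun p : {poly K} => p`_k) E; rewrite coef_deriv coef_sum => e.
by rewrite !mxE mulr_natl /= e; apply: eq_bigr => l _; rewrite coefZ !mxE.
Qed.

Lemma univ_act_coef X k : coefmx k (univ_act X) = (k`!%:R : K)^-1 *: infgen X ^+ k.
Proof.
elim: k => [|k IH]; first by rewrite univ_act_coef0 invr1 scale1r.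
have k0 : (k.+1%:R : K) != 0 by rewrite natK_eq0.
apply: (scalerI k0); rewrite univ_act_coefS IH -scalemxAr scalerA factS natrM.
by rewrite invfM mulrA mulfV // mul1r exprS.
Qed.

(** The action is polynomial in t, and its coefficient of t^k is, up to the
factor k!, the k-th power of the generator. *)
Lemma infgen_nilp X : exists n, infgen X ^+ n = 0.
Proof.
pose D := (\max_i \max_j size (univ_act X i j))%N; exists D.
have: coefmx D (univ_act X) = 0.
  apply/matrixP => i j; rewrite !mxE /= nth_default //.
  by apply: leq_trans (leq_bigmax i); apply: (leq_bigmax j).
by rewrite univ_act_coef => /eqP; rewrite scaler_eq0 invr_eq0 (negPf (factK_neq0 D)) => /eqP.
Qed.

Lemma ract_exp X (R : comAlgType K) (a : Ga K R) n : infgen X ^+ n = 0 ->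
  ract X a = \sum_(k < n) (a : R) ^+ k *: extmx R ((k`!%:R)^-1 *: infgen X ^+ k).
Proof.
move=> Nn; rewrite ract_univ; apply/matrixP => i j.
rewrite mxE (@evpE _ _ _ n); last first.
  apply/leq_sizeP => k nk.
  have := univ_act_coef X k => /matrixP/(_ i j); rewrite !mxE /= => ->.
  by rewrite -(subnKC nk) exprD Nn mul0r mxE mulr0.
rewrite summxE; apply: eq_bigr => k _.
by rewrite -univ_act_coef !mxE /= -scalerAr mulr1.
Qed.

(** The exponential formula makes the action a polynomial in the generator, and
conversely the generator is a coefficient of the action. *)
Lemma is_homP X Y (f : 'M[K]_(rdim Y, rdim X)) :
  is_hom X Y f <-> infgen Y *m f = f *m infgen X.
Proof.
split=> [fh|fN R x].
  have := fh _ ('X : Ga K {poly K}); rewrite -/(univ_act X) -/(univ_act Y).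
  move/(congr1 (coefmx 1))/matrixP => e; apply/matrixP => i j; have := e i j.
  rewrite !mxE /= !coef_sum => e'; apply: etrans (etrans e' _).
    by apply: eq_bigr => l _; rewrite !mxE /= alg_polyC coefMC.
  by apply: eq_bigr => l _; rewrite !mxE /= alg_polyC coefCM.
have [m Xm] := infgen_nilp X; have [n Yn] := infgen_nilp Y.
have Xmn : infgen X ^+ (m + n) = 0 by rewrite exprD Xm mul0r.
have Ymn : infgen Y ^+ (m + n) = 0 by rewrite addnC exprD Yn mul0r.
rewrite (ract_exp _ Xmn) (ract_exp _ Ymn) mulmx_suml mulmx_sumr.
apply: eq_bigr => k _; rewrite -scalemxAl -scalemxAr -!extmxM; congr (_ *: extmx R _).
rewrite -scalemxAl -scalemxAr; congr (_ *: _).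
elim: (k : nat) => [|l IH]; first by rewrite mulmx1 mul1mx.
by rewrite !exprSr -!mulmxE -mulmxA fN mulmxA IH mulmxA.
Qed.

Lemma infgen_tens X Y : infgen (rtens X Y) = infgen X *t 1%:M + 1%:M *t infgen Y.
Proof.
have e0 Z i j : (univ_act Z i j)`_0 = (1%:M : 'M[K]_(rdim Z)) i j.
  by rewrite -univ_act_coef0 mxE.
have e1 Z i j : (univ_act Z i j)`_1 = infgen Z i j by rewrite mxE.
apply/matrixP => i j; rewrite !mxE /= coefM big_ord_recl big_ord1 /= !e0 !e1 addrC.
by rewrite !mxE.
Qed.

Lemma infgen_unit : infgen runit = 0.
Proof. by apply/matrixP => i j; rewrite !mxE /= coefMn coef1 mul0rn. Qed.

End CharZero.

(** * Symmetric powers of the standard representation *)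

Section SymPowers.
Variable K : fieldType.

Lemma coef_XaddC_exp (R : comNzRingType) (a : R) j k :
  (('X + a%:P) ^+ j)`_k = a ^+ (j - k) *+ 'C(j, k).
Proof.
rewrite addrC exprDn coef_sum.
under eq_bigr => i _ do rewrite -polyC_exp coefMn coefCM coefXn.
case: (ltnP k j.+1) => kj; last first.
  rewrite bin_small // big1 // => i _.
  by rewrite gtn_eqF ?mulr0 ?mul0rn //; apply: leq_trans kj.
rewrite (bigD1 (Ordinal kj)) //= eqxx mulr1 big1 ?addr0 // => i.
by rewrite -val_eqE /= eq_sym => /negPf ->; rewrite mulr0 mul0rn.
Qed.

(** The operator x d/dy on Sym^n, in the basis indexed by the degree in y. *)
Definition raising m : 'M[K]_m.+1 := \matrix_(k, j) (j * (j == k.+1 :> nat))%:R.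

Section Action.
Variable n : nat.

(** Sym^n V as the polynomials of degree at most n in y (that is, x = 1), on
which a acts by substituting y + a for y; the basis is y^0, ..., y^n. *)
Definition sym_act (R : comAlgType K) (a : Ga K R) : 'M[R]_n.+1 :=
  \matrix_(k, j) ((a : R) ^+ (j - k) *+ 'C(j, k)).

Lemma sym_act1 (R : comAlgType K) : sym_act (gone : Ga K R) = 1%:M.
Proof.
apply/matrixP => k j; rewrite !mxE -coef_XaddC_exp addr0 coefXn.
by rewrite -val_eqE.
Qed.

Lemma sym_actM (R : comAlgType K) (a b : Ga K R) :
  sym_act (gmul a b) = sym_act a *m sym_act b.
Proof.
apply/matrixP => k j; rewrite !mxE -coef_XaddC_exp.
have -> : 'X + (gmul a b : R)%:P = ('X + (b : R)%:P) \Po ('X + (a : R)%:P).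
  by rewrite comp_polyD comp_polyX comp_polyC -addrA -polyCD.
rewrite -rmorphXn /= coef_comp_poly.
have sz : size (('X + (b : R)%:P) ^+ j) = j.+1.
  by rewrite -[b]opprK polyCN size_exp_XsubC.
rewrite sz (big_ord_widen n.+1 (fun i =>
  (('X + (b : R)%:P) ^+ j)`_i * (('X + (a : R)%:P) ^+ i)`_k)) //.
rewrite big_mkcond; apply: eq_bigr => l _; rewrite !mxE mulrC !coef_XaddC_exp.
by case: ltnP => // jl; rewrite (bin_small jl) mulr0n ?mulr0 ?mul0r.
Qed.

Lemma sym_act_nat (R S : comAlgType K) (f : {lrmorphism R -> S}) (a : Ga K R) :
  sym_act (kmap (Ga K) f a) = map_mx f (sym_act a).
Proof. by apply/matrixP => k j; rewrite !mxE rmorphMn rmorphXn. Qed.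

Definition sym : rep (Ga K) := Rep sym_act1 sym_actM sym_act_nat.

Lemma infgen_sym : infgen sym = raising n.
Proof.
apply/matrixP => k j; rewrite !mxE natrM mulr_natr /= coefMn coefXn.
have [->|jk] := eqVneq (j : nat) k.+1.
  by rewrite binSn subSnn.
case: (ltngtP j k) => [jk'|kj|->]; first by rewrite bin_small.
  by rewrite ltn_eqF ?mul0rn // ltn_subRL addn1 ltn_neqAle eq_sym jk kj.
by rewrite subnn mul0rn.
Qed.

End Action.

Definition std := sym 1.

Lemma std_act (R : comAlgType K) (a : Ga K R) : ract std a = phi_mx (a : R).
Proof.
apply/matrixP => i j; rewrite !mxE.
case: splitP => k; rewrite ord1 mxE => ik; case: splitP => l; rewrite ord1 => jl;
  rewrite !mxE ik jl.
- by rewrite bin0.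
- by rewrite bin0 /= mulr1n.
- by rewrite bin_small.
- by rewrite bin1.
Qed.

End SymPowers.

Section Multiplication.
Variable K : fieldType.
Hypothesis charK0 : [pchar K]%R =i pred0.

(** In the predecessor j.-1, the value at j = 0 does not matter: it is multiplied
by j. *)
Lemma sum_raisingr m (F : nat -> nat) (j : 'I_m.+1) :
  \sum_(l < m.+1) (F l)%:R * raising K m l j = (F j.-1 * j)%:R.
Proof.
transitivity (\sum_(l < m.+1) (F l * j * (l == j.-1 :> nat))%:R : K).
  apply: eq_bigr => l _; rewrite mxE -natrM; congr (_%:R).
  by case: (j : nat) => [|i] /=; [rewrite !(muln0, mul0n) | rewrite eqSS eq_sym mulnA].
rewrite -natr_sum (sumn_delta _ _ (fun l => F l * j)%N).
by rewrite (leq_ltn_trans (leq_pred _) (ltn_ord j)) muln1.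
Qed.

Lemma sum_raisingl m (F : nat -> nat) (k : 'I_m.+1) :
  \sum_(l < m.+1) raising K m k l * (F l)%:R = (k.+1 * F k.+1 * (k < m))%:R.
Proof.
transitivity (\sum_(l < m.+1) (l * F l * (l == k.+1 :> nat))%:R : K).
  apply: eq_bigr => l _; rewrite mxE -natrM; congr (_%:R).
  by rewrite -!mulnA; congr muln; rewrite mulnC.
by rewrite -natr_sum (sumn_delta _ _ (fun l => l * F l)%N).
Qed.

Section Maps.
Variable n : nat.
Local Notation V := (std K).

(** Multiplication V (x) Sym^n V -> Sym^(n+1) V. The basis of V is x, y, of
degree 0 and 1 in y, so indices add up. *)
Definition pmul : 'M[K]_(n.+2, 2 * n.+1) :=
  \matrix_(k < n.+2, q < (2 * n.+1)%N)
    (k == (@mxtens_unindex 2 n.+1 q).1 + (@mxtens_unindex 2 n.+1 q).2 :> nat)%N%:R.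

Definition polar_coef (u k : nat) := if u == 0%N then (n.+1 - k)%N else k.

(** Polarization Sym^(n+1) V -> V (x) Sym^n V, which maps f to
x (x) df/dx + y (x) df/dy. *)
Definition polar : 'M[K]_(2 * n.+1, n.+2) :=
  \matrix_(q < (2 * n.+1)%N, k < n.+2) (polar_coef (@mxtens_unindex 2 n.+1 q).1 k *
    (k == (@mxtens_unindex 2 n.+1 q).1 + (@mxtens_unindex 2 n.+1 q).2 :> nat)%N)%:R.

Lemma pmulE k u j : pmul k (mxtens_index (u, j)) = (k == u + j :> nat)%N%:R.
Proof. by rewrite mxE mxtens_indexK. Qed.

Lemma polarE u j k :
  polar (mxtens_index (u, j)) k = (polar_coef u k * (k == u + j :> nat)%N)%:R.
Proof. by rewrite mxE mxtens_indexK. Qed.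

Lemma pmul_hom : is_hom (rtens V (sym K n)) (sym K n.+1) pmul.
Proof.
apply/(is_homP charK0); rewrite infgen_tens !infgen_sym mulmxDr.
apply/matrixP => k q; case: (mxtens_indexP q) => u j {q}.
rewrite [RHS]mxE mul_tens1E mul_1tensE mxE.
under eq_bigr => l _ do rewrite pmulE.
under [X in _ = X + _]eq_bigr => v _ do rewrite pmulE.
under [X in _ = _ + X]eq_bigr => l _ do rewrite pmulE.
rewrite (sum_raisingl (fun l => nat_of_bool (l == u + j))%N).
rewrite (sum_raisingr (fun l => nat_of_bool ((k : nat) == u + l))%N).
rewrite (sum_raisingr (fun l => nat_of_bool ((k : nat) == l + j))%N) -natrD; congr (_%:R).
case: u => [[|[|//]] ?] /=; have := ltn_ord j; have := ltn_ord k.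
  case: j => [[|j] ?] /=; case: k => k ? /=; case: eqP; lia.
by case: j => [[|j] ?] /=; case: k => k ? /=; lia.
Qed.

Lemma polar_hom : is_hom (sym K n.+1) (rtens V (sym K n)) polar.
Proof.
apply/(is_homP charK0); rewrite infgen_tens !infgen_sym mulmxDl.
apply/matrixP => q k; case: (mxtens_indexP q) => u j {q}.
rewrite [LHS]mxE tens1_mulE tens_mul1E [RHS]mxE.
under [RHS]eq_bigr => l _ do rewrite polarE.
under [X in X + _ = _]eq_bigr => v _ do rewrite polarE.
under [X in _ + X = _]eq_bigr => l _ do rewrite polarE.
rewrite (sum_raisingr (fun l => polar_coef u l * (l == u + j))%N).
rewrite (sum_raisingl (fun l => polar_coef l k * ((k : nat) == l + j))%N).
rewrite (sum_raisingl (fun l => polar_coef u k * ((k : nat) == u + l))%N).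
rewrite -natrD; congr (_%:R).
have := ltn_ord j; have := ltn_ord k; rewrite /polar_coef /=.
case: u => [[|[|//]] ?] /=; case: k => [[|k] ?] /=; case: j => [j ?] /=.
- by rewrite !(muln0, mul0n).
- rewrite !add0n eqSS; have [->|_] := eqVneq k j; last by rewrite !muln0.
  rewrite subSS !muln1 !mul1n => _; rewrite ltnS leq_eqVlt => /predU1P[->|jn].
    by rewrite subnn ltnn !muln0 subSnn mul1n addn0.
  by rewrite jn subSn ?(ltnW jn) // muln1 [RHS]mulnC mulnS.
- by rewrite !(muln0, mul0n).
- rewrite !add1n !eqSS; have [->|_] := eqVneq k j.+1; last by rewrite !muln0.
  by rewrite !ltnS => jn _; rewrite jn muln0 !muln1 mulnC.
Qed.

(** Euler's identity x df/dx + y df/dy = (n + 1) f. *)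
Lemma pmul_polar : pmul *m polar = n.+1%:R%:M.
Proof.
apply/matrixP => k l.
have S0 : \sum_(j < n.+1)
    pmul k (mxtens_index (ord0, j)) * polar (mxtens_index (ord0, j)) l =
    ((n.+1 - l) * (l == k :> nat) * (k < n.+1))%:R.
  transitivity (\sum_(j < n.+1) ((n.+1 - l) * (l == j :> nat) * (j == k :> nat))%:R : K).
    apply: eq_bigr => j _; rewrite pmulE polarE -natrM /= !add0n mulnC.
    by rewrite [(k : nat) == _]eq_sym.
  by rewrite -natr_sum (sumn_delta _ _ (fun j => (n.+1 - l) * (l == j :> nat))%N).
have S1 : \sum_(j < n.+1)
    pmul k (mxtens_index (ord_max, j)) * polar (mxtens_index (ord_max, j)) l =
    (l * (l == k :> nat))%:R.
  transitivity (\sum_(j < n.+1) (l * (l == j.+1 :> nat) * (0 < k) * (j == k.-1 :> nat))%:R : K).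
    apply: eq_bigr => j _; rewrite pmulE polarE -natrM /= !add1n mulnC; congr (_%:R).
    case: (k : nat) => [|i] /=; first by rewrite !muln0.
    by rewrite eqSS [i == _]eq_sym muln1.
  rewrite -natr_sum (sumn_delta _ _ (fun j => l * (l == j.+1 :> nat) * (0 < k))%N).
  congr (_%:R); move: (k : nat) (ltn_ord k) => [|i] /= ki.
    by case: (l : nat) => *; rewrite !muln0.
  by rewrite -ltnS ki !muln1.
rewrite mxE sum_tens big_ord_recl big_ord1.
rewrite (_ : lift _ _ = ord_max) ?S0 ?S1; last exact: val_inj.
rewrite -natrD mxE -[RHS]mulr_natr -natrM; congr (_%:R).
rewrite [l == k :> nat]eq_sym -val_eqE /=.
have [kl|_] := eqVneq (k : nat) l; last by rewrite !muln0.
have := ltn_ord l; rewrite -kl !muln1 ltnS leq_eqVlt => /predU1P[->|kn].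
  by rewrite subnn ltnn.
by rewrite kn muln1 subnK // ltnW.
Qed.
End Maps.

Lemma polar_pmul0 : polar 0 *m pmul 0 = 1%:M.
Proof.
apply/matrixP => p q; case: (mxtens_indexP p) => u j; case: (mxtens_indexP q) => v l.
rewrite mxE !big_ord_recl big_ord0 !polarE !pmulE !mxE (can_eq (@mxtens_indexK _ _)).
rewrite xpair_eqE !ord1 eqxx andbT addr0.
case: u v => [[|[|//]] ?] [[|[|//]] ?] //=;
  by rewrite /polar_coef /= ?mul0n ?muln1 ?mulr0 ?mulr1 ?(addr0, add0r).
Qed.
End Multiplication.

(** * The alternating form and the Clebsch-Gordan relations *)

Lemma det_mx22 (R : comNzRingType) (M : 'M[R]_2) :
  \det M = M 0 0 * M 1 1 - M 0 1 * M 1 0.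
Proof.
rewrite (expand_det_row M 0) !big_ord_recl big_ord0 addr0 /cofactor !det_mx11 !mxE /=.
rewrite expr0 mul1r mulN1r mulrN.
by congr (M _ _ * M _ _ - M _ _ * M _ _); apply: val_inj.
Qed.

Lemma ord2P (u : 'I_2) : u = 0 \/ u = 1.
Proof. by case: u => [[|[|//]] ?]; [left | right]; apply: val_inj. Qed.

Section Form.
Variable R : comNzRingType.

(** The alternating form on the basis x, y of V. *)
Definition alt (u v : 'I_2) : R := (u < v)%:R - (v < u)%:R.

Definition capmx : 'M[R]_(1, 2 * 2) :=
  \row_q alt (@mxtens_unindex 2 2 q).1 (@mxtens_unindex 2 2 q).2.

Definition cupmx : 'M[R]_(2 * 2, 1) := capmx^T.

Lemma capmxE i u v : capmx i (mxtens_index (u, v)) = alt u v.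
Proof. by rewrite mxE mxtens_indexK. Qed.

Lemma cupmxE i u v : cupmx (mxtens_index (u, v)) i = alt u v.
Proof. by rewrite mxE capmxE. Qed.

Lemma capmx_mul (M : 'M[R]_2) : capmx *m (M *t M) = \det M *: capmx.
Proof.
apply/matrixP => i q; case: (mxtens_indexP q) => u v {q}.
rewrite det_mx22 !mxE mxtens_indexK sum_tens !big_ord_recl !big_ord0 !capmxE !tensmxE.
rewrite /alt /= !addr0 (_ : lift _ _ = 1); last exact: val_inj.
case: (ord2P u) => ->; case: (ord2P v) => -> /=; ring.
Qed.

Lemma cupmx_mul (M : 'M[R]_2) : (M *t M) *m cupmx = \det M *: cupmx.
Proof.
by rewrite -[M in LHS]trmxK -trmx_tens -trmx_mul capmx_mul det_tr linearZ.
Qed.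

Lemma capmx_cupmx : capmx *m cupmx = 2%:R%:M.
Proof.
apply/matrixP => i j; rewrite !ord1 !mxE sum_tens !big_ord_recl !big_ord0.
rewrite !capmxE !cupmxE /alt /=; ring.
Qed.
End Form.

Lemma capmx_map (R S : comNzRingType) (f : {rmorphism R -> S}) : map_mx f (capmx R) = capmx S.
Proof. by apply/matrixP => i j; rewrite !mxE rmorphB !rmorph_nat. Qed.

Lemma cupmx_map (R S : comNzRingType) (f : {rmorphism R -> S}) : map_mx f (cupmx R) = cupmx S.
Proof. by rewrite -map_trmx capmx_map. Qed.

Section CG.
Variable K : fieldType.
Hypothesis charK0 : [pchar K]%R =i pred0.
Local Notation V := (std K).

(** The action on V has determinant 1. *)
Lemma cap_hom : is_hom (rtens V V) runit (capmx K).
Proof.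
move=> R a; rewrite /extmx capmx_map /= /tens_act mul1mx std_act capmx_mul.
by rewrite phi_subproof scale1r.
Qed.

Lemma cup_hom : is_hom runit (rtens V V) (cupmx K).
Proof.
move=> R a; rewrite /extmx cupmx_map /= /tens_act mulmx1 std_act cupmx_mul.
by rewrite phi_subproof scale1r.
Qed.

Lemma alt_uniq (f : 'I_2 -> 'I_2 -> K) :
  (forall u v, f v u = - f u v) -> forall u v, f u v = f 0 1 * alt K u v.
Proof.
move=> fN u v; have f0 w : f w w = 0.
  have /eqP := fN w w; rewrite -addr_eq0 -mulr2n -mulr_natl mulf_eq0 natK_eq0 //.
  by move/eqP.
rewrite /alt; case: (ord2P u) => ->; case: (ord2P v) => ->;
  rewrite ?f0 ?subr0 ?sub0r ?mulr0 ?mulr1 ?mulrN1 //; exact: fN.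
Qed.

Lemma alt_swap u v : alt K v u = - alt K u v.
Proof. by rewrite opprB. Qed.

Lemma cap_swap : capmx K *m rswap V V = - capmx K.
Proof.
apply/matrixP => i q; case: (mxtens_indexP q) => u v {q}.
have := mul_rswapE (X := V) (Y := V) (idfun : {rmorphism K -> K}) (capmx K) i u v.
rewrite map_mx_id // => e; apply: etrans e _.
by rewrite capmxE alt_swap -(capmxE K i) [RHS]mxE.
Qed.

Lemma cup_swap : rswap V V *m cupmx K = - cupmx K.
Proof.
apply/matrixP => q i; case: (mxtens_indexP q) => u v {q}.
have := rswap_mulE (X := V) (Y := V) (idfun : {rmorphism K -> K}) (cupmx K) i u v.
rewrite map_mx_id // => e; apply: etrans e _.
by rewrite cupmxE alt_swap -(cupmxE K i) [RHS]mxE.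
Qed.

(** The space of alternating forms on V is a line, since 2 is invertible. *)
Lemma skew_cap (c : 'M[K]_(1, 2 * 2)) :
  c *m rswap V V = - c -> exists x, c = x *: capmx K.
Proof.
move=> cs; exists (c 0 (mxtens_index (0, 1))); apply/matrixP => i q.
case: (mxtens_indexP q) => u v {q}; rewrite [i]ord1 mxE capmxE.
apply: (alt_uniq (f := fun u v => c 0 (mxtens_index (u, v)))) => {}u {}v.
have := mul_rswapE (X := V) (Y := V) (idfun : {rmorphism K -> K}) c 0 u v.
by rewrite map_mx_id // cs mxE => <-.
Qed.

Lemma skew_cup (c : 'M[K]_(2 * 2, 1)) :
  rswap V V *m c = - c -> exists x, c = x *: cupmx K.
Proof.
move=> cs; exists (c (mxtens_index (0, 1)) 0); apply/matrixP => q i.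
case: (mxtens_indexP q) => u v {q}; rewrite [i]ord1 mxE cupmxE.
apply: (alt_uniq (f := fun u v => c (mxtens_index (u, v)) 0)) => {}u {}v.
have := rswap_mulE (X := V) (Y := V) (idfun : {rmorphism K -> K}) c 0 u v.
by rewrite map_mx_id // cs mxE => <-.
Qed.

(** The map f |-> x (x) y f - y (x) x f: insert the dual of the alternating form,
then multiply its second factor by f. It has to be this composite and not a
matrix of coefficients, so that compatibility with tensor automorphisms is
inherited from the factors. *)
Definition delta n : 'M[K]_(2 * n.+2, n.+1) :=
  (1%:M *t pmul K n) *m (rassoc V V (sym K n) *m
    ((cupmx K *t 1%:M) *m (runitl (sym K n))^T)).

(** The map x (x) f |-> df/dy, y (x) f |-> - df/dx, defined as a composite for the
same reason as delta. *)
Definition gamma n : 'M[K]_(n.+1, 2 * n.+2) :=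
  (runitl (sym K n) *m (capmx K *t 1%:M)) *m (rassoc V V (sym K n))^T *m
    (1%:M *t polar K n).

Lemma delta_sum n u z w :
  delta n (mxtens_index (u, z)) w =
  \sum_(v < 2) pmul K n z (mxtens_index (v, w)) * alt K u v.
Proof.
rewrite /delta tens_mul1E sum_tens; apply: eq_bigr => v _.
have E y : (rassoc V V (sym K n) *m ((cupmx K *t 1%:M) *m (runitl (sym K n))^T))
    (mxtens_index (u, mxtens_index (v, y))) w = alt K u v * (y == w)%:R.
  rewrite rassoc_mulE /runitl tr_castid mul_castid castmxE.
  rewrite (_ : cast_ord _ w = mxtens_index (ord0, w)); last exact: val_inj.
  by rewrite cast_ord_id tensmxE [X in _ * X]mxE cupmxE.
rewrite (bigD1 w) //= E eqxx mulr1 big1 ?addr0 // => y /negPf yw.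
by rewrite E yw !mulr0.
Qed.

Lemma gamma_sum n u z w :
  gamma n w (mxtens_index (u, z)) =
  \sum_(v < 2) alt K u v * polar K n (mxtens_index (v, w)) z.
Proof.
rewrite /gamma mul_1tensE sum_tens; apply: eq_bigr => v _.
have E y : (runitl (sym K n) *m (capmx K *t 1%:M) *m (rassoc V V (sym K n))^T)
    w (mxtens_index (u, mxtens_index (v, y))) = alt K u v * (y == w)%:R.
  rewrite mul_rassocTE /runitl castid_mul castmxE.
  rewrite (_ : cast_ord _ w = mxtens_index (ord0, w)); last exact: val_inj.
  by rewrite cast_ord_id tensmxE [X in _ * X]mxE capmxE [w == y]eq_sym.
rewrite (bigD1 w) //= E eqxx mulr1 big1 ?addr0 // => y /negPf yw.
by rewrite E yw mulr0 mul0r.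
Qed.

Lemma deltaE n u z w : delta n (mxtens_index (u, z)) w =
  if u == 0 then (z == w.+1 :> nat)%:R else - (z == w :> nat)%:R.
Proof.
rewrite delta_sum !big_ord_recl big_ord0 !pmulE addr0 /alt.
by case: (ord2P u) => -> /=; rewrite ?subrr ?mulr0 ?add0r ?addr0 ?subr0 ?sub0r ?mulr1 ?mulrN1.
Qed.

Lemma gammaE n u z w : gamma n w (mxtens_index (u, z)) =
  if u == 0 then (z * (z == w.+1 :> nat))%:R else - ((n.+1 - z) * (z == w :> nat))%:R.
Proof.
rewrite gamma_sum !big_ord_recl big_ord0 !polarE addr0 /alt.
by case: (ord2P u) => -> /=;
  rewrite ?subrr ?mul0r ?add0r ?addr0 ?subr0 ?sub0r ?mul1r ?mulN1r.
Qed.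

(** The Clebsch-Gordan decomposition of V (x) Sym^(n+1) V into Sym^(n+2) V and
Sym^n V. On x (x) f, with f of degree n + 1, the two terms add up to
x (x) (f + x df/dx + y df/dy) = (n + 2) x (x) f by Euler's identity. *)
Lemma polar_pmulS n :
  polar K n.+1 *m pmul K n.+1 + delta n *m gamma n = n.+2%:R%:M.
Proof.
have PP u j v l : (polar K n.+1 *m pmul K n.+1) (mxtens_index (u, j)) (mxtens_index (v, l))
  = (polar_coef n.+1 u (u + j) * (u + j == v + l))%N%:R.
  rewrite mxE; transitivity (\sum_(k < n.+3)
    (polar_coef n.+1 u k * (k == v + l :> nat) * (k == u + j :> nat))%N%:R : K).
    by apply: eq_bigr => k _; rewrite polarE pmulE -natrM mulnAC.
  rewrite -natr_sum (sumn_delta _ _ (fun k => polar_coef n.+1 u k * (k == v + l))%N).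
  by rewrite (_ : (u + j < n.+3)%N) ?muln1 //; case: u j => [u ?] [j ?] /=; lia.
apply/matrixP => p q; case: (mxtens_indexP p) => u j; case: (mxtens_indexP q) => v l {p q}.
rewrite mxE PP !mxE (can_eq (@mxtens_indexK _ _)) xpair_eqE.
under eq_bigr => w _ do rewrite deltaE gammaE.
case: (ord2P u) => ->; case: (ord2P v) => -> /=; rewrite ?add0n ?add1n /polar_coef /=.
- rewrite (eq_bigr (fun w : 'I_n.+1 => ((j == w.+1 :> nat) * l * (w == l.-1 :> nat))%:R)).
    rewrite -natr_sum (sumn_delta _ _ (fun w => (j == w.+1 :> nat) * l)%N).
    rewrite -natrD -[RHS]mulr_natr -natrM; congr (_%:R); rewrite -val_eqE /=.
    case: j l => [j ?] [[|l] ?] /=; first by rewrite !muln0; case: eqP => [->|]; lia.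
    by case: eqP => [->|]; lia.
  by move=> w _; rewrite -natrM; congr (_%:R); case: (l : nat) => [|i] /=;
    rewrite ?(muln0, mul0n) // eqSS [i == _]eq_sym mulnA.
- rewrite (eq_bigr (fun w : 'I_n.+1 =>
    - ((j == w.+1 :> nat) * (n.+1 - l) * (w == l :> nat))%:R)).
    rewrite sumrN -natr_sum (sumn_delta _ _ (fun w => (j == w.+1 :> nat) * (n.+1 - l))%N).
    apply/eqP; rewrite mulr0n subr_eq0; apply/eqP; congr (_%:R).
    by case: eqP => [->|]; have := ltn_ord j; case: (j : nat) => [|i] /=; nia.
  by move=> w _; rewrite mulrN -natrM mulnA [l == w :> nat]eq_sym.
- rewrite (eq_bigr (fun w : 'I_n.+1 => - ((j == w :> nat) * l * (w == l.-1 :> nat))%:R)).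
    rewrite sumrN -natr_sum (sumn_delta _ _ (fun w => (j == w :> nat) * l)%N).
    apply/eqP; rewrite mulr0n subr_eq0; apply/eqP; congr (_%:R).
    case: j l => [j ?] [[|l] ?] /=; first by rewrite !muln0.
    by rewrite eqSS; case: eqP => [->|]; lia.
  move=> w _; rewrite mulNr -natrM; congr (- _%:R); case: (l : nat) => [|i] /=;
    by rewrite ?(muln0, mul0n) // eqSS [i == _]eq_sym mulnA.
- rewrite (eq_bigr (fun w : 'I_n.+1 => ((j == w :> nat) * (n.+1 - l) * (w == l :> nat))%:R)).
    rewrite -natr_sum (sumn_delta _ _ (fun w => (j == w :> nat) * (n.+1 - l))%N).
    rewrite -natrD -[RHS]mulr_natr -natrM; congr (_%:R).
    rewrite -val_eqE /= eqSS; case: j l => [j ?] [l ?] /=.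
    by case: eqP => [->|]; nia.
  by move=> w _; rewrite mulrNN -natrM mulnA [l == w :> nat]eq_sym.
Qed.

(** Polarization normalized to be a section of the multiplication. *)
Definition npolar n : 'M[K]_(2 * n.+1, n.+2) := (n.+1%:R)^-1 *: polar K n.

Lemma npolar_hom n : is_hom (sym K n.+1) (rtens V (sym K n)) (npolar n).
Proof. exact: is_homZ (polar_hom charK0 n). Qed.

Lemma pmul_npolar n : pmul K n *m npolar n = 1%:M.
Proof.
by rewrite -scalemxAr pmul_polar scale_scalar_mx mulVf ?natK_eq0.
Qed.

Lemma npolar_pmulS n :
  npolar n.+1 *m pmul K n.+1 + delta n *m (n.+2%:R^-1 *: gamma n) = 1%:M.
Proof.
rewrite /npolar -scalemxAl -scalemxAr -scalerDr polar_pmulS scale_scalar_mx.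
by rewrite mulVf ?natK_eq0.
Qed.

Lemma delta_hom n : is_hom (sym K n) (rtens V (sym K n.+1)) (delta n).
Proof.
have [u1 u2] := runitl_inv (sym K n); have h1 := is_hom_inv u1 u2 (runitl_hom (sym K n)).
have h2 := is_hom_tens cup_hom (is_hom1 (sym K n)).
have h4 := is_hom_tens (is_hom1 V) (pmul_hom charK0 n).
exact: is_homM h4 (is_homM (rassoc_hom V V (sym K n)) (is_homM h2 h1)).
Qed.

Lemma gamma_hom n : is_hom (rtens V (sym K n.+1)) (sym K n) (gamma n).
Proof.
have [u1 u2] := rassoc_inv V V (sym K n).
have h2 := is_hom_inv u1 u2 (rassoc_hom V V (sym K n)).
have h3 := is_hom_tens cap_hom (is_hom1 (sym K n)).
have h1 := is_hom_tens (is_hom1 V) (polar_hom charK0 n).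
exact: is_homM (is_homM (is_homM (runitl_hom (sym K n)) h3) h2) h1.
Qed.

Lemma sym0_hom : is_hom (sym K 0) runit (1%:M : 'M[K]_1).
Proof.
apply/(is_homP charK0); rewrite infgen_unit infgen_sym mul0mx mul1mx.
by apply/matrixP => i j; rewrite !mxE !ord1.
Qed.

Lemma sym0_hom_inv : is_hom runit (sym K 0) (1%:M : 'M[K]_1).
Proof. by apply: is_hom_inv sym0_hom; rewrite mulmx1. Qed.

End CG.

(** * Schur lemma modulo the radical, and the Jordan decomposition *)

Section Schur.
Variable K : fieldType.
Hypothesis charK0 : [pchar K]%R =i pred0.
Local Notation S := (sym K).

Lemma raising_mulE n m (A : 'M[K]_(n.+1, m)) (k : 'I_n.+1) j :
  (raising K n *m A) k j = k.+1%:R * (A (inord k.+1) j *+ (k < n)%N).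
Proof.
rewrite mxE; case: ltnP => kn.
  rewrite (bigD1 (inord k.+1)) //= big1 ?addr0 => [|l]; rewrite !mxE.
    by rewrite inordK // eqxx muln1 mulr1n.
  by rewrite -val_eqE /= inordK // => /negPf ->; rewrite muln0 mul0r.
rewrite mulr0 big1 // => l _; rewrite mxE ltn_eqF ?muln0 ?mul0r //.
exact: leq_trans (ltn_ord l) _.
Qed.

Lemma mul_raisingE n m (A : 'M[K]_(m, n.+1)) k (j : 'I_n.+1) :
  (A *m raising K n) k j = A k (inord j.-1) * j%:R.
Proof.
have jn : (j.-1 < n.+1)%N := leq_ltn_trans (leq_pred _) (ltn_ord j).
rewrite mxE (bigD1 (inord j.-1)) //= big1 ?addr0 => [|l]; rewrite !mxE.
  rewrite inordK //; congr (_ * _%:R).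
  by case: (j : nat) => [|i] //=; rewrite eqxx muln1.
rewrite -val_eqE /= inordK // => lj; case: (j : nat) lj => [|i] /= li.
  by rewrite mul0n mulr0.
by rewrite eqSS eq_sym (negPf li) muln0 mulr0.
Qed.

Lemma inord0 p : inord 0 = 0 :> 'I_p.+1.
Proof. by apply: val_inj; rewrite /= inordK. Qed.

Section Hom.
Variables (m n : nat) (h : 'M[K]_(n.+1, m.+1)).
Hypothesis hh : is_hom (S m) (S n) h.
Local Notation H k j := (h (inord k) (inord j)).

Let hE (k : 'I_n.+1) (j : 'I_m.+1) :
  k.+1%:R * (h (inord k.+1) j *+ (k < n)%N) = h k (inord j.-1) * j%:R.
Proof.
have /(is_homP charK0) := hh; rewrite !infgen_sym => /matrixP/(_ k j).
by rewrite raising_mulE mul_raisingE.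
Qed.

Let H0 k : (k < n)%N -> H k.+1 0%N = 0.
Proof.
move=> kn; have kn' : (k < n.+1)%N by rewrite ltnS ltnW.
have := hE (inord k) (inord 0).
rewrite !inordK ?kn // mulr0 mulr1n => /eqP.
by rewrite mulf_eq0 natK_eq0 // => /eqP.
Qed.

Let HS k j : (k < n)%N -> (j < m)%N -> k.+1%:R * H k.+1 j.+1 = H k j * j.+1%:R.
Proof.
move=> kn jm; have := hE (inord k) (inord j.+1).
by rewrite !inordK ?kn // ltnS ltnW.
Qed.

(** Comparing entries of raising * h = h * raising determines each entry by the
previous one on the same diagonal. *)
Lemma sym_hom_low j k : (k <= n)%N -> (j <= m)%N -> (j < k)%N -> H k j = 0.
Proof.
elim: j k => [|j IH] [|k] // kn jm jk; first exact: H0.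
have /eqP := HS kn jm; rewrite IH ?mul0r // ?(ltnW kn) ?(ltnW jm) // mulf_eq0 natK_eq0 //.
by move/eqP.
Qed.

Lemma sym_hom_diag k : (k <= n)%N -> (k <= m)%N -> H k k = H 0%N 0%N.
Proof.
elim: k => [//|k IH] kn km; rewrite -(IH (ltnW kn) (ltnW km)).
by apply: (mulfI (x := k.+1%:R)); rewrite ?natK_eq0 // HS // mulrC.
Qed.

Lemma sym_hom_low0 (k : 'I_n.+1) : k != 0 -> h k 0 = 0.
Proof.
move=> k0; have := @sym_hom_low 0%N k; rewrite inord_val inord0.
by apply; rewrite ?leq_ord // lt0n.
Qed.

(** Beyond the last row of h the recursion along the diagonal continues with 0,
so that the whole diagonal vanishes. *)
Lemma sym_hom_small : (n < m)%N -> h 0 0 = 0.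
Proof.
move=> nm; have := @sym_hom_diag n (leqnn n) (ltnW nm).
have := hE (inord n) (inord n.+1); rewrite !inordK // ltnn mulr0n mulr0 /= => /esym/eqP.
rewrite mulf_eq0 natK_eq0 // orbF => /eqP-> /esym.
by rewrite !inord0.
Qed.
End Hom.

(** A morphism is triangular with constant diagonal. *)
Lemma sym_end_unit n (f : 'M[K]_n.+1) : is_hom (S n) (S n) f -> f 0 0 != 0 -> f \in unitmx.
Proof.
move=> fh f0; rewrite unitmxE -det_tr det_trig.
  rewrite (eq_bigr (fun=> f 0 0)) => [|k _]; last first.
    rewrite mxE; have := sym_hom_diag fh (leq_ord k) (leq_ord k).
    by rewrite inord_val inord0.
  by rewrite prodr_const unitfE expf_neq0.
apply/is_trig_mxP => k j kj; rewrite mxE.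
have := sym_hom_low fh (leq_ord j) (leq_ord k) kj.
by rewrite !inord_val.
Qed.

(** Schur's lemma modulo the radical. The corner entry of a composite g f is the
product of the corner entries; it vanishes if m <> n, since one of f and g then
maps a larger power to a smaller one. So 1 - g f is unitriangular. *)
Lemma sym_hom00_rad m n (f : 'M[K]_(n.+1, m.+1)) :
  is_hom (S m) (S n) f -> (m != n) || (f 0 0 == 0) -> rad (S m) (S n) f.
Proof.
move=> fh f0; split=> // g gh.
have gf0 : (g *m f) 0 0 = 0.
  rewrite mxE big_ord_recl big1 ?addr0 => [|l _]; last first.
    by rewrite (sym_hom_low0 fh (k := lift ord0 l)) // mulr0.
  case/orP: f0 => [|/eqP f0]; last by rewrite (_ : ord0 = 0) // f0 mulr0.
  rewrite neq_ltn => /orP[mn|nm].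
    by rewrite (sym_hom_small gh) // mul0r.
  by rewrite (sym_hom_small fh) // mulr0.
have uh : is_hom (S m) (S m) (1%:M - g *m f).
  by apply: is_homD (is_hom1 _) (is_homN (is_homM gh fh)).
have uu : 1%:M - g *m f \in unitmx.
  apply: (sym_end_unit uh); rewrite [X in X != 0]mxE [X in _ + X]mxE gf0 subr0.
  by rewrite mxE eqxx oner_eq0.
split=> //; exists (invmx (1%:M - g *m f)); rewrite mulVmx ?mulmxV //; split=> //.
by apply: is_hom_inv uh; rewrite ?mulVmx ?mulmxV.
Qed.

(** The endomorphisms of X that are finite sums of morphisms factoring through
symmetric powers. *)
Inductive sum_sym (X : rep (Ga K)) : 'M[K]_(rdim X) -> Prop :=
  | sum_sym0 : sum_sym 0
  | sum_symD n (i : 'M[K]_(n.+1, rdim X)) (p : 'M[K]_(rdim X, n.+1)) M :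
      is_hom X (S n) i -> is_hom (S n) X p -> sum_sym M -> sum_sym (p *m i + M).

(** The Jordan decomposition, in terms of idempotents: split off a Jordan block of
maximal size from the image of e, and conclude by induction on the rank. *)
Lemma sum_sym_idem (X : rep (Ga K)) (e : 'M[K]_(rdim X)) :
  is_hom X X e -> e *m e = e -> sum_sym e.
Proof.
have [d] := ubnP (\rank e); elim: d e => // d IH e; rewrite ltnS => rd eh ee.
have [->|e0] := eqVneq e 0; first exact: sum_sym0.
set N := infgen X; have /(is_homP charK0) := eh; rewrite -/N => eN.
have eNk k : N ^+ k *m e = e *m N ^+ k.
  elim: k => [|k IHk]; first by rewrite mulmx1 mul1mx.
  by rewrite exprSr -!mulmxE -mulmxA eN mulmxA IHk mulmxA.
have ex : exists k, N ^+ k *m e == 0.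
  by have [k Nk] := infgen_nilp charK0 X; exists k; rewrite Nk mul0mx.
case: (ex_minnP ex) => [[|n]] /eqP Nn mn.
  by rewrite mul1mx in Nn; rewrite Nn eqxx in e0.
have {mn} Nn0 : N ^+ n *m e != 0 by apply/negP => /mn; rewrite ltnn.
have /existsP[r0 /existsP[c0 nz]] : [exists r, exists c, (N ^+ n *m e) r c != 0].
  apply: contraR Nn0 => /existsPn h; apply/eqP/matrixP => r c.
  by have /existsPn/(_ c)/negbNE/eqP-> := h r; rewrite mxE.
(* A Jordan chain of maximal length generated by the column c0 of e, and the dual
   chain generated by the row r0, both scaled so as to commute with raising.
   Their product has a nonzero corner, because N^n e does at (r0, c0). *)
pose p : 'M[K]_(rdim X, n.+1) := \matrix_(r, k) (k`!%:R * (N ^+ (n - k) *m e) r c0).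
pose i : 'M[K]_(n.+1, rdim X) := \matrix_(k, c) ((k`!%:R)^-1 * (e *m N ^+ k) r0 c).
have mulp A r k : (A *m p) r k = k`!%:R * (A *m (N ^+ (n - k) *m e)) r c0.
  by rewrite mxE [X in _ * X]mxE mulr_sumr; apply: eq_bigr => l _; rewrite mxE mulrCA.
have imul A k c : (i *m A) k c = (k`!%:R)^-1 * (e *m N ^+ k *m A) r0 c.
  by rewrite mxE [X in _ * X]mxE mulr_sumr; apply: eq_bigr => l _; rewrite mxE mulrA.
have ep : e *m p = p.
  by apply/matrixP => r k; rewrite mulp mulmxA -eNk -mulmxA ee [RHS]mxE.
have ie : i *m e = i.
  by apply/matrixP => k c; rewrite imul -mulmxA eNk mulmxA ee [RHS]mxE.
have ph : is_hom (S n) X p.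
  apply/(is_homP charK0)/matrixP => r k.
  rewrite -/N infgen_sym mulp mul_raisingE [p _ _]mxE.
  rewrite mulmxA mulmxE -exprS -mulmxE -subSn ?leq_ord //.
  case: k => [[|k] kn] /=; first by rewrite subn0 Nn mxE !mulr0.
  by rewrite inordK ?(ltnW kn) // subSS factS natrM [RHS]mulrC mulrA.
have ih : is_hom X (S n) i.
  apply/(is_homP charK0)/matrixP => k c.
  rewrite -/N infgen_sym imul raising_mulE [i _ _]mxE -mulmxA mulmxE -exprSr -mulmxE.
  case: ltnP => kn; last first.
    have -> : (k = n :> nat) by apply/anti_leq; rewrite kn leq_ord.
    by rewrite mulr0n mulr0 -eNk Nn mxE mulr0.
  rewrite inordK // factS natrM invfM mulr1n !mulrA mulfV ?mul1r //.
  by rewrite natK_eq0.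
have uh : is_hom (S n) (S n) (i *m p) by apply: is_homM ih ph.
have uu : i *m p \in unitmx.
  apply: (sym_end_unit uh).
  rewrite imul mulmx1 ep mxE mulf_neq0 ?invr_eq0 ?factK_neq0 //.
  by rewrite mulf_neq0 ?factK_neq0 // subn0.
pose v := p *m invmx (i *m p).
have vh : is_hom (S n) X v.
  by apply: is_homM ph _; apply: is_hom_inv uh; rewrite ?mulVmx ?mulmxV.
have iv : i *m v = 1%:M by rewrite mulmxA mulmxV.
have ev : e *m v = v by rewrite mulmxA ep.
rewrite -(subrK (v *m i) e) addrC; apply: sum_symD => //.
have ew : e *m (v *m i) = v *m i by rewrite mulmxA ev.
have we : (v *m i) *m e = v *m i by rewrite -mulmxA ie.
have ww : (v *m i) *m (v *m i) = v *m i by rewrite -mulmxA (mulmxA i) iv mul1mx.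
apply: IH; last 1 first.
- by rewrite mulmxBl !mulmxBr ee ew we ww subrr subr0.
- apply: leq_trans rd; apply: rank_ltmx; rewrite /ltmx.
  rewrite (_ : e - v *m i = (1%:M - v *m i) *m e) ?submxMl /=; last first.
    by rewrite mulmxBl mul1mx we.
  apply/negP => /submxP[x xe]; have v0 : v = 0.
    rewrite -ev xe !mulmxBl !mul1mx -(mulmxA v) -mulmxA mulmxBl -!mulmxA !ev iv.
    by rewrite mulmx1 subrr mulmx0.
  by have /matrixP/(_ 0 0)/eqP := iv; rewrite v0 mulmx0 !mxE eqxx eq_sym oner_eq0.
- exact: is_homD eh (is_homN (is_homM vh ih)).
Qed.

Lemma sum_sym1 (X : rep (Ga K)) : sum_sym (1%:M : 'M[K]_(rdim X)).
Proof. by apply: sum_sym_idem; [apply: is_hom1 | rewrite mul1mx]. Qed.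

End Schur.

(** * Maps compatible with a monoidal section *)

Section Equivariance.
Variables (K : fieldType) (G : kgroup K) (s : monoidal_section G).
Implicit Types X Y Z : rep G.

Lemma sec0 X Y : sec s X Y 0 = 0.
Proof.
have := sec_linear s 1 (is_hom0 X Y) (is_hom0 X Y).
by rewrite scale1r addr0 => /eqP; rewrite scale1r -subr_eq0 opprD addNKr oppr_eq0 => /eqP.
Qed.

Lemma secZ X Y a (f : 'M[K]_(rdim Y, rdim X)) :
  is_hom X Y f -> sec s X Y (a *: f) = a *: sec s X Y f.
Proof.
move=> fh; have := sec_linear s a fh (is_hom0 X Y).
by rewrite sec0 !addr0.
Qed.

Lemma secD X Y (f g : 'M[K]_(rdim Y, rdim X)) :
  is_hom X Y f -> is_hom X Y g -> sec s X Y (f + g) = sec s X Y f + sec s X Y g.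
Proof. by move=> fh gh; have := sec_linear s 1 fh gh; rewrite !scale1r. Qed.

(** The section factors through the quotient by the radical. *)
Lemma sec_rad X Y (f : 'M[K]_(rdim Y, rdim X)) : rad X Y f -> sec s X Y f = 0.
Proof.
move=> fr; rewrite -(sec0 X Y); apply: sec_eqbar; [by case: fr | exact: is_hom0 |].
by rewrite /eqbar subr0.
Qed.

Lemma sec_mulV X Y (f : 'M[K]_(rdim Y, rdim X)) (g : 'M[K]_(rdim X, rdim Y)) :
  is_hom X Y f -> is_hom Y X g -> f *m g = 1%:M -> sec s X Y f *m sec s Y X g = 1%:M.
Proof. by move=> fh gh fg; rewrite -(sec_comp s gh fh) fg sec_id. Qed.

Lemma mu_unit X Y : mu s X Y \in unitmx.
Proof. by have [_ [g [_ _ /mulmx1_unit[]]]] := mu_iso s X Y. Qed.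

Lemma eps_unit : eps s \in unitmx.
Proof. by have [_ [g [_ _ /mulmx1_unit[]]]] := eps_iso s. Qed.

Variable R : comAlgType K.

(** The morphism s(f) over R intertwines gX and gY. Pairs (X, gX) and such f form
a monoidal category, and a tensor endomorphism of omega_s is a monoidal section
of the projection (X, gX) |-> X. *)
Definition equivariant X Y (gX : 'M[R]_(rdim X)) (gY : 'M[R]_(rdim Y))
    (f : 'M[K]_(rdim Y, rdim X)) : Prop :=
  gY *m extmx R (sec s X Y f) = extmx R (sec s X Y f) *m gX.

(** The tensor product of gX and gY on omega_s(X (x) Y), transported along mu. *)
Definition tens_along X Y (gX : 'M[R]_(rdim X)) (gY : 'M[R]_(rdim Y)) :
    'M[R]_(rdim (rtens X Y)) :=
  extmx R (mu s X Y) *m (gX *t gY) *m extmx R (invmx (mu s X Y)).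

Lemma tens_along_mu X Y (gX : 'M[R]_(rdim X)) (gY : 'M[R]_(rdim Y)) :
  tens_along gX gY *m extmx R (mu s X Y) = extmx R (mu s X Y) *m (gX *t gY).
Proof. by rewrite -mulmxA -extmxM mulVmx ?mu_unit // extmx1 mulmx1. Qed.

Lemma mu_inj X Y m (A B : 'M[R]_(m, rdim (rtens X Y))) :
  A *m extmx R (mu s X Y) = B *m extmx R (mu s X Y) -> A = B.
Proof. exact/extmx_inj_mulr/mulmxV/mu_unit. Qed.

Section Equiv.
Variables (X Y Z : rep G) (gX : 'M[R]_(rdim X)) (gY : 'M[R]_(rdim Y)) (gZ : 'M[R]_(rdim Z)).

Lemma equivariant_id : equivariant gX gX 1%:M.
Proof. by rewrite /equivariant sec_id extmx1 mulmx1 mul1mx. Qed.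

Lemma equivariant_comp f g : is_hom X Y f -> is_hom Y Z g ->
  equivariant gX gY f -> equivariant gY gZ g -> equivariant gX gZ (g *m f).
Proof.
move=> fh gh fe ge; rewrite /equivariant (sec_comp s fh gh) extmxM mulmxA ge.
by rewrite -mulmxA fe mulmxA.
Qed.

Lemma equivariantD f g : is_hom X Y f -> is_hom X Y g ->
  equivariant gX gY f -> equivariant gX gY g -> equivariant gX gY (f + g).
Proof.
by move=> fh gh fe ge; rewrite /equivariant secD // extmxD mulmxDr mulmxDl fe ge.
Qed.

Lemma equivariantZ a f : is_hom X Y f -> equivariant gX gY f -> equivariant gX gY (a *: f).
Proof. by move=> fh fe; rewrite /equivariant secZ // extmxZ -scalemxAr -scalemxAl fe. Qed.

Lemma equivariant_inv f g : is_hom X Y f -> f *m g = 1%:M -> g *m f = 1%:M ->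
  equivariant gX gY f -> equivariant gY gX g.
Proof.
move=> fh fg gf fe; have gh := is_hom_inv fg gf fh.
have sfg := sec_mulV fh gh fg; have sgf := sec_mulV gh fh gf.
apply: (extmx_inj_mulr sfg).
by rewrite -[RHS]mulmxA fe [RHS]mulmxA -[LHS]mulmxA -!extmxM sgf extmx1 mulmx1 mul1mx.
Qed.
End Equiv.

Lemma equivariant_tens X X' Y Y' (gX : 'M[R]_(rdim X)) (gX' : 'M[R]_(rdim X'))
    (gY : 'M[R]_(rdim Y)) (gY' : 'M[R]_(rdim Y')) f g :
  is_hom X X' f -> is_hom Y Y' g -> equivariant gX gX' f -> equivariant gY gY' g ->
  equivariant (tens_along gX gY) (tens_along gX' gY') (f *t g).
Proof.
move=> fh gh fe ge; apply: mu_inj.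
rewrite -[LHS]mulmxA -[RHS]mulmxA tens_along_mu -extmxM -(mu_nat s fh gh) extmxM.
rewrite mulmxA tens_along_mu -mulmxA extmxT tensmx_mul fe ge -tensmx_mul -extmxT.
by rewrite !mulmxA -!extmxM (mu_nat s fh gh).
Qed.

Lemma equivariant_assoc X Y Z
    (gX : 'M[R]_(rdim X)) (gY : 'M[R]_(rdim Y)) (gZ : 'M[R]_(rdim Z)) :
  equivariant (tens_along (tens_along gX gY) gZ) (tens_along gX (tens_along gY gZ))
    (rassoc X Y Z).
Proof.
have T1 : mu s (rtens X Y) Z *m (mu s X Y *t 1%:M) *m
    ((invmx (mu s X Y) *t 1%:M) *m invmx (mu s (rtens X Y) Z)) = 1%:M.
  rewrite mulmxA -(mulmxA (mu s _ _)) tensmx_mul mulmxV ?mu_unit // mul1mx tens_id.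
  by rewrite mulmx1 mulmxV // mu_unit.
have L : tens_along (tens_along gX gY) gZ *m
      extmx R (mu s (rtens X Y) Z *m (mu s X Y *t 1%:M)) =
    extmx R (mu s (rtens X Y) Z *m (mu s X Y *t 1%:M)) *m (gX *t gY *t gZ).
  rewrite !extmxM mulmxA tens_along_mu -[LHS]mulmxA -[RHS]mulmxA extmxT !tensmx_mul extmx1.
  by rewrite tens_along_mu mulmx1 mul1mx.
have L' : tens_along gX (tens_along gY gZ) *m
      extmx R (mu s X (rtens Y Z) *m (1%:M *t mu s Y Z)) =
    extmx R (mu s X (rtens Y Z) *m (1%:M *t mu s Y Z)) *m (gX *t (gY *t gZ)).
  rewrite !extmxM mulmxA tens_along_mu -[LHS]mulmxA -[RHS]mulmxA extmxT !tensmx_mul extmx1.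
  by rewrite tens_along_mu mulmx1 mul1mx.
have A : (gX *t (gY *t gZ)) *m extmx R (rassoc X Y Z) =
    extmx R (rassoc X Y Z) *m (gX *t gY *t gZ).
  rewrite /rassoc /extmx map_castmx map_mx1 castid_mul mul_castid -tensmxA castmx_comp.
  by congr (castmx _ _); congr pair; apply: nat_irrelevance.
have E : sec s _ _ (rassoc X Y Z) *m (mu s (rtens X Y) Z *m (mu s X Y *t 1%:M)) =
    mu s X (rtens Y Z) *m (1%:M *t mu s Y Z) *m rassoc X Y Z by rewrite mulmxA sec_assoc.
apply: (extmx_inj_mulr T1).
rewrite -[LHS]mulmxA -[RHS]mulmxA L -extmxM E [X in _ *m X = _]extmxM.
rewrite [LHS]mulmxA L' -[LHS]mulmxA A.
by rewrite [LHS]mulmxA [RHS]mulmxA -!extmxM E.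
Qed.

Lemma equivariant_unitl X (gX : 'M[R]_(rdim X)) :
  equivariant (tens_along (1%:M : 'M[R]_(rdim (runit : rep G))) gX) gX (runitl X).
Proof.
have T1 : mu s runit X *m (eps s *t 1%:M) *m
    ((invmx (eps s) *t 1%:M) *m invmx (mu s runit X)) = 1%:M.
  rewrite mulmxA -(mulmxA (mu s _ _)) tensmx_mul mulmxV ?eps_unit // mul1mx tens_id.
  by rewrite mulmx1 mulmxV // mu_unit.
have L : tens_along 1%:M gX *m extmx R (mu s runit X *m (eps s *t 1%:M)) =
    extmx R (mu s runit X *m (eps s *t 1%:M)) *m (1%:M *t gX).
  rewrite !extmxM mulmxA tens_along_mu -[LHS]mulmxA -[RHS]mulmxA extmxT !tensmx_mul extmx1.
  by rewrite !mulmx1 !mul1mx.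
have A : gX *m extmx R (runitl X) = extmx R (runitl X) *m (1%:M *t gX).
  rewrite /runitl /extmx map_castmx map_mx1 castid_mul mul_castid.
  rewrite tens_scalar_mx scale1r castmx_comp.
  by congr (castmx _ _); congr pair; apply: nat_irrelevance.
have E : sec s _ _ (runitl X) *m (mu s runit X *m (eps s *t 1%:M)) = runitl X.
  by rewrite mulmxA sec_unitl.
apply: (extmx_inj_mulr T1).
by rewrite -[LHS]mulmxA -[RHS]mulmxA L -extmxM E [RHS]mulmxA -extmxM E.
Qed.

Lemma equivariant_unitr X (gX : 'M[R]_(rdim X)) :
  equivariant (tens_along gX (1%:M : 'M[R]_(rdim (runit : rep G)))) gX (runitr X).
Proof.
have T1 : mu s X runit *m (1%:M *t eps s) *m
    ((1%:M *t invmx (eps s)) *m invmx (mu s X runit)) = 1%:M.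
  rewrite mulmxA -(mulmxA (mu s _ _)) tensmx_mul mulmxV ?eps_unit // mul1mx tens_id.
  by rewrite mulmx1 mulmxV // mu_unit.
have L : tens_along gX 1%:M *m extmx R (mu s X runit *m (1%:M *t eps s)) =
    extmx R (mu s X runit *m (1%:M *t eps s)) *m (gX *t 1%:M).
  rewrite !extmxM mulmxA tens_along_mu -[LHS]mulmxA -[RHS]mulmxA extmxT !tensmx_mul extmx1.
  by rewrite !mulmx1 !mul1mx.
have A : gX *m extmx R (runitr X) = extmx R (runitr X) *m (gX *t 1%:M).
  rewrite /runitr /extmx map_castmx map_mx1 castid_mul mul_castid.
  rewrite tens_mx_scalar scale1r castmx_comp.
  by congr (castmx _ _); congr pair; apply: nat_irrelevance.
have E : sec s _ _ (runitr X) *m (mu s X runit *m (1%:M *t eps s)) = runitr X.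
  by rewrite mulmxA sec_unitr.
apply: (extmx_inj_mulr T1).
by rewrite -[LHS]mulmxA -[RHS]mulmxA L -extmxM E [RHS]mulmxA -extmxM E.
Qed.

Lemma tens_endP (g : forall X, 'M[R]_(rdim X)) :
  tens_end s g <->
  [/\ forall X Y f, is_hom X Y f -> equivariant (g X) (g Y) f,
      forall X Y, g (rtens X Y) = tens_along (g X) (g Y) & g runit = 1%:M].
Proof.
split=> -[gn gt gu]; split=> //.
- by move=> X Y; apply: mu_inj; rewrite tens_along_mu.
- have := mulmxV eps_unit => e; apply: (extmx_inj_mulr e).
  by rewrite gu mul1mx.
- by move=> X Y; rewrite gt tens_along_mu.
- by rewrite gu mul1mx.
Qed.

(** The image of an equivariant idempotent inherits a structure from X, for which
both the projection and the inclusion are equivariant. *)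
Lemma equivariant_split X Y (gX : 'M[R]_(rdim X)) f f' : is_hom X Y f -> is_hom Y X f' ->
  f *m f' = 1%:M -> equivariant gX gX (f' *m f) ->
  let gY := extmx R (sec s X Y f) *m gX *m extmx R (sec s Y X f') in
  equivariant gX gY f /\ equivariant gY gX f'.
Proof.
move=> fh fh' ff e; have sff := sec_mulV fh fh' ff.
move: e; rewrite /equivariant (sec_comp s fh fh') extmxM => e; split.
  by rewrite -mulmxA -[LHS]mulmxA e !mulmxA -extmxM sff extmx1 mul1mx.
by rewrite !mulmxA -e -!mulmxA -extmxM sff extmx1 mulmx1.
Qed.
End Equivariance.

(** * Tensor endomorphisms of the fibre functor and their values on the plane *)

Section TensorEndomorphisms.
Variable K : fieldType.
Hypothesis charK0 : [pchar K]%R =i pred0.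
Variable s : monoidal_section (Ga K).
Local Notation V := (std K).
Local Notation S := (sym K).

(** By the compatibility of s with the symmetry, s(cap) mu is antisymmetric. *)
Lemma sec_capP : exists x, sec s (rtens V V) runit (capmx K) *m mu s V V = x *: capmx K.
Proof.
apply: (skew_cap charK0).
have := sec_sym s V V => e; apply: etrans (esym (mulmxA _ _ _)) _.
rewrite -e mulmxA -(sec_comp s (rswap_hom V V) (@cap_hom K)) cap_swap.
rewrite -scaleN1r secZ ?scaleN1r ?mulNmx //; exact: cap_hom.
Qed.

Lemma sec_cupP : exists x, invmx (mu s V V) *m sec s runit (rtens V V) (cupmx K) = x *: cupmx K.
Proof.
apply: (skew_cup charK0).
have e : rswap V V *m invmx (mu s V V) =
    invmx (mu s V V) *m sec s (rtens V V) (rtens V V) (rswap V V).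
  rewrite -[RHS]mulmx1 -(mulmxV (mu_unit s V V)) mulmxA -(mulmxA (invmx _)) sec_sym.
  by rewrite mulmxA mulVmx ?mu_unit // mul1mx.
rewrite mulmxA e -mulmxA -(sec_comp s (@cup_hom K) (rswap_hom V V)) cup_swap.
rewrite -scaleN1r secZ ?scaleN1r ?mulmxN //; exact: cup_hom.
Qed.

Section Points.
Variable R : comAlgType K.

(** The images under s of the maps from symmetric powers to X are jointly
epimorphic, as s preserves the decomposition of the identity of X. *)
Lemma sec_epi X m (A B : 'M[R]_(m, rdim X)) :
  (forall n f, is_hom (S n) X f ->
     A *m extmx R (sec s (S n) X f) = B *m extmx R (sec s (S n) X f)) -> A = B.
Proof.
move=> AB; suff h M : sum_sym M -> is_hom X X M /\
    A *m extmx R (sec s X X M) = B *m extmx R (sec s X X M).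
  by have [_] := h _ (sum_sym1 charK0 X); rewrite sec_id extmx1 !mulmx1.
elim=> [|n i p M' ih ph _ [M'h IH]].
  by split; [exact: is_hom0 | rewrite sec0 extmx0 !mulmx0].
have pih := is_homM ph ih.
split; first exact: is_homD.
by rewrite secD // extmxD !mulmxDr IH (sec_comp s ih ph) extmxM !mulmxA AB.
Qed.

(** As for X itself: the decomposition of the identity of X is tensored with Y. *)
Lemma sec_epi_tensl X Y m (A B : 'M[R]_(m, rdim (rtens X Y))) :
  (forall n f, is_hom (S n) X f ->
     A *m extmx R (sec s (rtens (S n) Y) (rtens X Y) (f *t 1%:M)) =
     B *m extmx R (sec s (rtens (S n) Y) (rtens X Y) (f *t 1%:M))) -> A = B.
Proof.
move=> AB; suff h M : sum_sym M -> is_hom X X M /\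
    A *m extmx R (sec s (rtens X Y) (rtens X Y) (M *t 1%:M)) =
    B *m extmx R (sec s (rtens X Y) (rtens X Y) (M *t 1%:M)).
  by have [_] := h _ (sum_sym1 charK0 X); rewrite tens_id sec_id extmx1 !mulmx1.
elim=> [|n i p M' ih ph _ [M'h IH]].
  by split; [exact: is_hom0 | rewrite tens0mx sec0 extmx0 !mulmx0].
have hY := is_hom1 Y; have pih := is_homM ph ih; split; first exact: is_homD.
rewrite tensmxDl secD; [|exact: is_hom_tens|exact: is_hom_tens].
have -> : p *m i *t (1%:M : 'M[K]_(rdim Y)) = (p *t 1%:M) *m (i *t 1%:M).
  by rewrite tensmx_mul mulmx1.
have ih' := is_hom_tens ih hY; have ph' := is_hom_tens ph hY.
by rewrite extmxD !mulmxDr IH (sec_comp s ih' ph') extmxM !mulmxA AB.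
Qed.

Lemma sec_epi_tensr X Y m (A B : 'M[R]_(m, rdim (rtens Y X))) :
  (forall n f, is_hom (S n) X f ->
     A *m extmx R (sec s (rtens Y (S n)) (rtens Y X) (1%:M *t f)) =
     B *m extmx R (sec s (rtens Y (S n)) (rtens Y X) (1%:M *t f))) -> A = B.
Proof.
move=> AB; suff h M : sum_sym M -> is_hom X X M /\
    A *m extmx R (sec s (rtens Y X) (rtens Y X) (1%:M *t M)) =
    B *m extmx R (sec s (rtens Y X) (rtens Y X) (1%:M *t M)).
  by have [_] := h _ (sum_sym1 charK0 X); rewrite tens_id sec_id extmx1 !mulmx1.
elim=> [|n i p M' ih ph _ [M'h IH]].
  by split; [exact: is_hom0 | rewrite tensmx0 sec0 extmx0 !mulmx0].
have hY := is_hom1 Y; have pih := is_homM ph ih; split; first exact: is_homD.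
rewrite tensmxDr secD; [|exact: is_hom_tens|exact: is_hom_tens].
have -> : (1%:M : 'M[K]_(rdim Y)) *t (p *m i) = (1%:M *t p) *m (1%:M *t i).
  by rewrite tensmx_mul mulmx1.
have ih' := is_hom_tens hY ih; have ph' := is_hom_tens hY ph.
by rewrite extmxD !mulmxDr IH (sec_comp s ih' ph') extmxM !mulmxA AB.
Qed.

(** A split epimorphism determines the structure on its target. *)
Lemma equivariant_uniq X Y (gX : 'M[R]_(rdim X)) (gY gY' : 'M[R]_(rdim Y)) f f' :
  is_hom X Y f -> is_hom Y X f' -> f *m f' = 1%:M ->
  equivariant s gX gY f -> equivariant s gX gY' f -> gY = gY'.
Proof.
move=> fh fh' ff e e'; apply: (extmx_inj_mulr (sec_mulV s fh fh' ff)).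
by rewrite [LHS]e [RHS]e'.
Qed.

Section SL2.
Variable M : 'M[R]_2.
Hypothesis M1 : \det M = 1.
Local Notation gV := (M : 'M[R]_(rdim V)).
Local Notation g1 := (1%:M : 'M[R]_(rdim (@runit K (Ga K)))).

(** M (x) M multiplies the determinant form by det M = 1, and s(cap) is a multiple
of the form. *)
Lemma cap_equivariant : equivariant s (tens_along s gV gV) g1 (capmx K).
Proof.
have [x ex] := sec_capP; apply: (mu_inj (s := s)).
rewrite mul1mx -[RHS]mulmxA tens_along_mu mulmxA -extmxM ex extmxZ /extmx capmx_map.
by rewrite -scalemxAl capmx_mul M1 scale1r.
Qed.

Lemma cup_equivariant : equivariant s g1 (tens_along s gV gV) (cupmx K).
Proof.
have [x ex] := sec_cupP.
rewrite /equivariant mulmx1 /tens_along -mulmxA -extmxM ex -[LHS]mulmxA extmxZ /extmx cupmx_map.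
rewrite -scalemxAr cupmx_mul M1 scale1r -(cupmx_map (in_alg R)) -/(extmx R _) -extmxZ -ex.
by rewrite -extmxM mulmxA mulmxV ?mu_unit // mul1mx.
Qed.

(** The action of M on Sym^n V, seen through s: the restriction of its action on
V (x) Sym^(n-1) V to the summand Sym^n V. *)
Fixpoint sl2_sym n : 'M[R]_n.+1 :=
  if n is m.+1 then
    extmx R (sec s (rtens V (S m)) (S m.+1) (pmul K m)) *m
    tens_along s gV (sl2_sym m : 'M_(rdim (S m))) *m
    extmx R (sec s (S m.+1) (rtens V (S m)) (npolar K m))
  else 1%:M.
Local Notation sl2S n := (sl2_sym n : 'M[R]_(rdim (S n))).

Lemma delta_equivariant n (a : 'M[R]_(rdim (S n))) (b : 'M[R]_(rdim (S n.+1))) :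
  equivariant s (tens_along s gV a) b (pmul K n) ->
  equivariant s a (tens_along s gV b) (delta K n).
Proof.
move=> pe; have ph := pmul_hom charK0 n; have [u1 u2] := runitl_inv (S n).
have h1 := is_hom_inv u1 u2 (runitl_hom (S n)).
have e1 := equivariant_inv (runitl_hom (S n)) u1 u2 (equivariant_unitl s a).
have h2 := is_hom_tens (@cup_hom K) (is_hom1 (S n)).
have e2 := equivariant_tens (@cup_hom K) (is_hom1 (S n)) cup_equivariant (equivariant_id s a).
have h3 := rassoc_hom V V (S n); have e3 := equivariant_assoc s gV gV a.
have h4 := is_hom_tens (is_hom1 V) ph.
have e4 := equivariant_tens (is_hom1 V) ph (equivariant_id s gV) pe.
have h12 := is_homM h2 h1; have h123 := is_homM h3 h12.
exact: equivariant_comp h123 h4 (equivariant_comp h12 h3 (equivariant_comp h1 h2 e1 e2) e3) e4.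
Qed.

Lemma gamma_equivariant n (a : 'M[R]_(rdim (S n))) (b : 'M[R]_(rdim (S n.+1))) :
  equivariant s b (tens_along s gV a) (polar K n) ->
  equivariant s (tens_along s gV b) a (gamma K n).
Proof.
move=> pe; have ph := polar_hom charK0 n; have [u1 u2] := rassoc_inv V V (S n).
have h1 := is_hom_tens (is_hom1 V) ph.
have e1 := equivariant_tens (is_hom1 V) ph (equivariant_id s gV) pe.
have h2 := is_hom_inv u1 u2 (rassoc_hom V V (S n)).
have e2 := equivariant_inv (rassoc_hom V V (S n)) u1 u2 (equivariant_assoc s gV gV a).
have h3 := is_hom_tens (@cap_hom K) (is_hom1 (S n)).
have e3 := equivariant_tens (@cap_hom K) (is_hom1 (S n)) cap_equivariant (equivariant_id s a).
have h4 := runitl_hom (S n); have e4 := equivariant_unitl s a.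
have h34 := is_homM h4 h3; have h234 := is_homM h34 h2.
exact: equivariant_comp h1 h234 e1 (equivariant_comp h2 h34 e2 (equivariant_comp h3 h4 e3 e4)).
Qed.

(** By equivariant_split it is enough that the idempotent npolar * pmul of
V (x) Sym^n V is equivariant. It is the identity for n = 0; otherwise it is
1 - delta gamma / (n + 1), where delta and gamma are equivariant by induction. *)
Lemma sl2_sym_equivariant n :
  equivariant s (tens_along s gV (sl2S n)) (sl2S n.+1) (pmul K n) /\
  equivariant s (sl2S n.+1) (tens_along s gV (sl2S n)) (npolar K n).
Proof.
elim: n => [|n [IHa IHb]].
  apply: equivariant_split (pmul_hom charK0 0) (npolar_hom charK0 0) (pmul_npolar charK0 0) _.
  rewrite /npolar invr1 scale1r polar_pmul0; exact: equivariant_id.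
have n1 : (n.+1%:R : K) != 0 by rewrite natK_eq0.
have IHc : equivariant s (sl2S n.+1) (tens_along s gV (sl2S n)) (polar K n).
  rewrite -[polar K n]scale1r -(mulfV n1) -scalerA.
  exact: equivariantZ (npolar_hom charK0 n) IHb.
have dh := delta_hom charK0 n; have de := delta_equivariant IHa.
have gh := gamma_hom charK0 n; have ge := gamma_equivariant IHc.
apply: equivariant_split (pmul_hom charK0 _) (npolar_hom charK0 _) (pmul_npolar charK0 _) _.
have -> : npolar K n.+1 *m pmul K n.+1 = 1%:M + (- (n.+2%:R)^-1) *: (delta K n *m gamma K n).
  have := polar_pmulS K n => /(canRL (addrK _)) e.
  rewrite -scalemxAl e scalerBr scale_scalar_mx mulVf ?natK_eq0 //.
  by rewrite scaleNr.
apply: equivariantD (equivariant_id _ _) _.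
- exact: is_hom1.
- exact: is_homZ (is_homM dh gh).
- exact: equivariantZ (is_homM dh gh) (equivariant_comp gh dh ge de).
Qed.

(** Sym^(n+2) V and Sym^n V together exhaust V (x) Sym^(n+1) V. *)
Lemma clebsch_gordan_uniq n (a : 'M[R]_(rdim (S n.+2))) (b : 'M[R]_(rdim (S n)))
    (c c' : 'M[R]_(rdim (rtens V (S n.+1)))) :
  equivariant s a c (npolar K n.+1) -> equivariant s b c (delta K n) ->
  equivariant s a c' (npolar K n.+1) -> equivariant s b c' (delta K n) -> c = c'.
Proof.
move=> ca cb ca' cb'.
have qh := npolar_hom charK0 n.+1; have ph := pmul_hom charK0 n.+1.
have dh := delta_hom charK0 n; have gh := is_homZ (n.+2%:R^-1) (gamma_hom charK0 n).
have F : 1%:M = extmx R (sec s (S n.+2) (rtens V (S n.+1)) (npolar K n.+1)) *m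
    extmx R (sec s (rtens V (S n.+1)) (S n.+2) (pmul K n.+1)) +
    extmx R (sec s (S n) (rtens V (S n.+1)) (delta K n)) *m
    extmx R (sec s (rtens V (S n.+1)) (S n) (n.+2%:R^-1 *: gamma K n)).
  rewrite -!extmxM -(sec_comp s ph qh) -(sec_comp s gh dh) -extmxD -secD.
  - by rewrite (npolar_pmulS charK0) sec_id extmx1.
  - exact: is_homM qh ph.
  - exact: is_homM dh gh.
by rewrite -[c]mulmx1 -[c']mulmx1 F !mulmxDr !mulmxA ca cb ca' cb'.
Qed.

(** Multiplication V (x) Sym^0 V -> V is the unit constraint, which is
equivariant for M. *)
Lemma sl2_sym1 : sl2_sym 1 = M.
Proof.
have [e1 _] := sl2_sym_equivariant 0.
have jh := sym0_hom charK0.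
have je : equivariant s (sl2S 0) g1 (1%:M : 'M[K]_1).
  by rewrite /equivariant mul1mx mulmx1.
have rh := is_hom_tens (is_hom1 V) jh.
have te := equivariant_tens (is_hom1 V) jh (equivariant_id s gV) je.
have e2 := equivariant_comp rh (runitr_hom V) te (equivariant_unitr s gV).
have pE : runitr V *m (1%:M *t (1%:M : 'M[K]_1)) = pmul K 0.
  rewrite tens_id mulmx1; apply/matrixP => k q; case: (mxtens_indexP q) => u j.
  rewrite pmulE castmxE mxE /= ord1 addn0; congr (_%:R); congr nat_of_bool.
  by rewrite -!val_eqE /= muln1 addn0.
rewrite {}pE in e2.
have pp := sec_mulV s (pmul_hom charK0 0) (npolar_hom charK0 0) (pmul_npolar charK0 0).
by apply: (extmx_inj_mulr pp); rewrite [LHS]e1 [RHS]e2.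
Qed.

(** By Schur's lemma modulo the radical, s(h) is 0 or a scalar. *)
Lemma sl2_sym_natural m n (h : 'M[K]_(n.+1, m.+1)) :
  is_hom (S m) (S n) h -> equivariant s (sl2S m) (sl2S n) h.
Proof.
move=> hh; have [mn|mn] := eqVneq m n; last first.
  have h0 : rad (S m) (S n) h by apply: (sym_hom00_rad charK0 hh); rewrite mn.
  by rewrite /equivariant (sec_rad s h0) extmx0 mulmx0 mul0mx.
subst n; have ch := is_homZ (h 0 0) (is_hom1 (S m)).
have h0 : eqbar (S m) (S m) h (h 0 0 *: 1%:M).
  apply: (sym_hom00_rad charK0); first exact: is_homD hh (is_homN ch).
  by rewrite !mxE eqxx mulr1 subrr eqxx orbT.
rewrite /equivariant (sec_eqbar s hh ch h0) (secZ s _ (is_hom1 (S m))) sec_id extmxZ extmx1.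
by rewrite -scalemxAl -scalemxAr mulmx1 mul1mx.
Qed.

(** If 1 = sum of p_j i_j with i_j : X -> Sym^(n_j) V, then gX is the sum of the
s(p_j) g_(n_j) s(i_j); naturality on symmetric powers makes it compatible with
every map from a symmetric power to X. *)
Lemma extend_sl2_sym (X : rep (Ga K)) : exists gX : 'M[R]_(rdim X),
  forall n f, is_hom (S n) X f -> equivariant s (sl2S n) gX f.
Proof.
suff h N : sum_sym N -> is_hom X X N /\ exists gX : 'M[R]_(rdim X),
    forall n f, is_hom (S n) X f ->
    gX *m extmx R (sec s (S n) X f) = extmx R (sec s (S n) X (N *m f)) *m sl2S n.
  have [_ [gX gE]] := h _ (sum_sym1 charK0 X); exists gX => n f /gE.
  by rewrite mul1mx.
elim=> [|n i p M' ih ph _ [M'h [g gE]]].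
  split; first exact: is_hom0.
  by exists 0 => n f _; rewrite mul0mx mul0mx sec0 extmx0 mul0mx.
have pih := is_homM ph ih; split; first exact: is_homD.
exists (extmx R (sec s (S n) X p) *m sl2S n *m extmx R (sec s X (S n) i) + g) => m f fh.
have ifh := is_homM ih fh.
rewrite mulmxDl gE // mulmxDl secD; [|exact: is_homM pih fh|exact: is_homM M'h fh].
rewrite extmxD mulmxDl; congr (_ + _).
rewrite -mulmxA -extmxM -(sec_comp s fh ih) -mulmxA (sl2_sym_natural ifh).
by rewrite mulmxA -extmxM -(sec_comp s ifh ph) mulmxA.
Qed.

Definition sl2_family (X : rep (Ga K)) : 'M[R]_(rdim X) := sval (cid (extend_sl2_sym X)).

Lemma sl2_family_equivariant X n f :
  is_hom (S n) X f -> equivariant s (sl2S n) (sl2_family X) f.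
Proof. by rewrite /sl2_family; case: (cid _) => gX /=; apply. Qed.

Lemma sl2_family_sym n : sl2_family (S n) = sl2_sym n.
Proof.
have := sl2_family_equivariant (is_hom1 (S n)).
by rewrite /equivariant sec_id extmx1 mulmx1 mul1mx.
Qed.

Lemma sl2_family_std : sl2_family V = M.
Proof. by rewrite sl2_family_sym sl2_sym1. Qed.

(** Naturality is checked on maps from symmetric powers, which are jointly
epimorphic. The compatibility with X (x) Y is established for X = V and Y a
symmetric power by Clebsch-Gordan, then for X = V and all Y, then for
X = Sym^m V by induction on m, as a summand of V (x) Sym^(m-1) V, and finally
for all X. *)
Lemma sl2_family_tens_end : tens_end s sl2_family.
Proof.
set g := sl2_family.
have gS X n f : is_hom (S n) X f -> equivariant s (sl2S n) (g X) f.
  exact: sl2_family_equivariant.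
have gn n : g (S n) = sl2_sym n := sl2_family_sym n.
have gV1 : g V = M := sl2_family_std.
have gnat X Y f : is_hom X Y f -> equivariant s (g X) (g Y) f.
  move=> fh; apply: sec_epi => n p ph.
  rewrite -[LHS]mulmxA -[RHS]mulmxA -extmxM -(sec_comp s ph fh) (gS _ _ _ ph).
  by rewrite (gS _ _ _ (is_homM fh ph)) (sec_comp s ph fh) extmxM mulmxA.
have gu : g runit = 1%:M.
  have [jh jh'] := (sym0_hom charK0, sym0_hom_inv charK0).
  apply: (equivariant_uniq (gX := sl2S 0) jh jh' (mulmx1 _) (gS _ _ _ jh)).
  by rewrite /equivariant mul1mx mulmx1.
have TVS n : g (rtens V (S n)) = tens_along s (g V) (g (S n)).
  have [pe qe] := sl2_sym_equivariant n.
  have ph := pmul_hom charK0 n; have qh := npolar_hom charK0 n.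
  case: n => [|n] in pe qe ph qh *.
    apply: (equivariant_uniq qh ph _ (gS _ _ _ qh)).
      by rewrite /npolar invr1 scale1r polar_pmul0.
    by rewrite gV1 gn.
  have [pe' _] := sl2_sym_equivariant n.
  have dh := delta_hom charK0 n; have de := delta_equivariant pe'.
  apply: (clebsch_gordan_uniq (gS _ _ _ qh) (gS _ _ _ dh)); by rewrite gV1 gn.
have TV Y : g (rtens V Y) = tens_along s (g V) (g Y).
  apply: sec_epi_tensr => n f fh; have fh' := is_hom_tens (is_hom1 V) fh.
  rewrite (gnat _ _ _ fh') TVS.
  exact/esym/(equivariant_tens (is_hom1 V) fh (equivariant_id _ _) (gnat _ _ _ fh)).
have TS m Y : g (rtens (S m) Y) = tens_along s (g (S m)) (g Y).
  elim: m Y => [|m IH] Y.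
    have [l1 l2] := runitl_inv Y; have lh := is_hom_inv l1 l2 (runitl_hom Y).
    have le := equivariant_inv (runitl_hom Y) l1 l2 (equivariant_unitl s (g Y)).
    have [j0 j0'] := (sym0_hom charK0, sym0_hom_inv charK0).
    have jh := is_hom_tens j0' (is_hom1 Y); have jh' := is_hom_tens j0 (is_hom1 Y).
    have lh' := is_homM (runitl_hom Y) jh'; have lh2 := is_homM jh lh.
    apply: (equivariant_uniq lh2 lh' _ (gnat _ _ _ lh2)).
      by rewrite mulmxA -(mulmxA (1%:M *t 1%:M)) l2 mulmx1 tensmx_mul !mulmx1 tens_id.
    apply: equivariant_comp lh jh le _; rewrite -gu.
    exact: (equivariant_tens j0' (is_hom1 Y) (gnat _ _ _ j0') (equivariant_id _ _)).
  have TU : g (rtens (rtens V (S m)) Y) = tens_along s (g (rtens V (S m))) (g Y).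
    have [a1 a2] := rassoc_inv V (S m) Y; have ah := rassoc_hom V (S m) Y.
    have ah' := is_hom_inv a1 a2 ah.
    apply: (equivariant_uniq ah' ah a2 (gnat _ _ _ ah')).
    by rewrite !TV IH; apply: equivariant_inv ah a1 a2 (equivariant_assoc _ _ _ _).
  have ph := pmul_hom charK0 m; have qh := npolar_hom charK0 m.
  have ph' := is_hom_tens ph (is_hom1 Y); have qh' := is_hom_tens qh (is_hom1 Y).
  apply: (equivariant_uniq ph' qh' _ (gnat _ _ _ ph')).
    by rewrite tensmx_mul (pmul_npolar charK0) mulmx1 tens_id.
  rewrite TU; exact: (equivariant_tens ph (is_hom1 Y) (gnat _ _ _ ph) (equivariant_id _ _)).
apply/tens_endP; split=> // X Y.
apply: sec_epi_tensl => n f fh; have fh' := is_hom_tens fh (is_hom1 Y).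
rewrite (gnat _ _ _ fh') TS.
exact/esym/(equivariant_tens fh (is_hom1 Y) (gnat _ _ _ fh) (equivariant_id _ _)).
Qed.

End SL2.

(** Sym^0 V is the unit, and Sym^(n+1) V is a summand of V (x) Sym^n V, so the
values on symmetric powers follow from the value on V. *)
Lemma tens_end_uniq (g h : forall X : rep (Ga K), 'M[R]_(rdim X)) :
  tens_end s g -> tens_end s h -> g V = h V -> forall X, g X = h X.
Proof.
move=> /tens_endP[gn gt gu] /tens_endP[hn ht hu] gh.
have ghS n : g (S n) = h (S n).
  elim: n => [|n IH].
    have [jh jh'] := (sym0_hom_inv charK0, sym0_hom charK0).
    apply: (equivariant_uniq jh jh' (mulmx1 _) (gn _ _ _ jh)).
    by rewrite gu -hu; apply: hn jh.
  have ph := pmul_hom charK0 n; have qh := npolar_hom charK0 n.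
  apply: (equivariant_uniq ph qh (pmul_npolar charK0 n) (gn _ _ _ ph)).
  by rewrite gt gh IH -ht; apply: hn ph.
move=> X; apply: sec_epi => n f fh.
by rewrite (gn _ _ _ fh) (hn _ _ _ fh) ghS.
Qed.

(** The form s(cap) mu = x cap is preserved by g V, which multiplies cap by
det (g V). The scalar x is not 0, because cap * cup = 2. *)
Lemma tens_end_det (g : forall X : rep (Ga K), 'M[R]_(rdim X)) :
  tens_end s g -> \det (g V) = 1.
Proof.
move=> /tens_endP[gn gt gu]; have [x ex] := sec_capP.
(* Otherwise s(cap) = 0, and s(cap) s(cup) could not be s(2) = 2. *)
have x0 : x != 0.
  apply/eqP => x0; rewrite x0 scale0r in ex.
  have ch := sec_comp s (@cup_hom K) (@cap_hom K).
  have : sec s runit runit (capmx K *m cupmx K) = 0.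
    rewrite ch -[sec s runit _ _]mul1mx -(mulmxV (mu_unit s V V)) -!mulmxA.
    by rewrite mulmxA ex mul0mx.
  rewrite capmx_cupmx -scalemx1 secZ; last exact: is_hom1.
  rewrite sec_id => /matrixP/(_ 0 0)/eqP; rewrite !mxE mulr1 natK_eq0 //.
have := gn _ _ _ (@cap_hom K); rewrite gu gt => e.
have : extmx R (x *: capmx K) = extmx R (x *: capmx K) *m (g V *t g V).
  by rewrite -ex extmxM -mulmxA -tens_along_mu mulmxA -e mul1mx.
rewrite extmxZ /extmx capmx_map -scalemxAl capmx_mul.
have xx : (x^-1)%:A * x%:A = 1 :> R by rewrite mulr_algl scalerA mulVf // scale1r.
move=> /(congr1 (fun A => (x^-1)%:A *: A)); rewrite !scalerA ?mulrA xx mul1r scale1r.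
move=> /matrixP/(_ 0 (mxtens_index (0, 1))) e1.
transitivity (capmx R 0 (mxtens_index (0, 1))); last by rewrite capmxE /alt subr0.
by rewrite e1 mxE capmxE /alt /= subr0 mulr1.
Qed.

End Points.
End TensorEndomorphisms.

(** * The pro-reductive envelope and the unipotent complement *)

Section Envelope.
Variable K : fieldType.
Hypothesis charK0 : [pchar K]%R =i pred0.
Variable s : monoidal_section (Ga K).
Local Notation V := (std K).

Lemma phi_mxE (R : comAlgType K) (a : R) (i j : 'I_2) : phi_mx a i j = a ^+ (j - i) *+ 'C(j, i).
Proof. by rewrite -(std_act (a : Ga K R)) mxE. Qed.

Section RedIso.

Definition red_pt (R : comAlgType K) (g : pRed s R) : SL2 K R :=
  mk_sl2 (tens_end_det charK0 (svalP g).1).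

Lemma red_ptM (R : comAlgType K) (g h : pRed s R) :
  red_pt (gmul g h) = gmul (red_pt g) (red_pt h).
Proof. exact: sig_eqP. Qed.

Lemma red_pt_nat (R S : comAlgType K) (f : {lrmorphism R -> S}) (g : pRed s R) :
  red_pt (kmap (pRed s) f g) = kmap (SL2 K) f (red_pt g).
Proof. exact: sig_eqP. Qed.

Definition red_hom : khom (pRed s) (SL2 K) := KHom red_ptM red_pt_nat.

Lemma sl2_family_aut (R : comAlgType K) (M : 'M[R]_2) (M1 : \det M = 1) :
  tens_aut s (sl2_family charK0 s M).
Proof.
pose N := sl2_inv_subproof (mk_sl2 M1).
have ge := sl2_family_tens_end charK0 s M1; have he := sl2_family_tens_end charK0 s N.
have MN : M *m \adj M = 1%:M by rewrite mul_mx_adj M1.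
split=> //; exists (sl2_family charK0 s (\adj M)) => X; split.
  apply: (tens_end_uniq charK0 (tens_endM ge he) (tens_end1 s R) _ X).
  by rewrite !sl2_family_std.
apply: (tens_end_uniq charK0 (tens_endM he ge) (tens_end1 s R) _ X).
by rewrite !sl2_family_std //= mul_adj_mx M1.
Qed.

Lemma red_hom_iso : kiso red_hom.
Proof.
move=> R; exists (fun M : SL2 K R => exist _ _ (sl2_family_aut (svalP M)) : pRed s R).
  move=> g; apply: mxfam_eqP => X /=.
  have M1 := tens_end_det charK0 (svalP g).1.
  apply: (tens_end_uniq charK0 (sl2_family_tens_end charK0 s M1) (svalP g).1).
  exact: sl2_family_std.
by move=> M; apply: sig_eqP; apply: sl2_family_std (svalP M).
Qed.

Lemma red_hom_sharp (R : comAlgType K) (a : Ga K R) : red_hom R (sharp s R a) = phi K R a.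
Proof. by apply: sig_eqP; apply: std_act. Qed.

End RedIso.

Section Unip.
Variable R : comAlgType K.

Lemma ext_span_sum m n (P : 'M[K]_(m, n) -> Prop) (I : Type) (r : seq I) (Q : pred I)
    (c : I -> R) (F : I -> 'M[K]_(m, n)) : (forall i, Q i -> P (F i)) ->
  ext_span P (\sum_(i <- r | Q i) c i *: extmx R (F i)).
Proof.
move=> PF; apply: big_rec => [|i M Qi PM]; first exact: ext_span0.
by apply: ext_spanD PM; apply: PF.
Qed.

Lemma infgen_pow_hom (X : rep (Ga K)) a k : is_hom X X (a *: infgen X ^+ k).
Proof.
apply: is_homZ; apply/(is_homP charK0); rewrite !mulmxE.
by rewrite -exprS -exprSr.
Qed.

(** All morphisms commute with the generator, so that the composite of the power
with any morphism is nilpotent. *)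
Lemma infgen_pow_rad (X : rep (Ga K)) a k : rad X X (a *: infgen X ^+ k.+1).
Proof.
split; first exact: infgen_pow_hom.
move=> g gh; set f := a *: _; have fh : is_hom X X f := infgen_pow_hom X a k.+1.
have [n Xn] := infgen_nilp charK0 X; set N := infgen X in f fh Xn *.
have wN := (is_homP charK0 _).1 (is_homM gh (infgen_pow_hom X a k)).
have fE : g *m f = g *m (a *: infgen X ^+ k) *m N.
  by rewrite /f exprSr -[in LHS]mulmxE scalemxAl mulmxA.
have u_nilp : (g *m f) ^+ n = 0.
  by rewrite fE mulmxE exprMn_comm ?Xn ?mulr0 //; apply/esym.
set u := g *m f in u_nilp *; have uh : is_hom X X (1%:M - u).
  exact: is_homD (is_hom1 _) (is_homN (is_homM gh fh)).
have uV : (1%:M - u) *m (\sum_(i < n) u ^+ i) = 1%:M.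
  have := subrX1 u n; rewrite u_nilp sub0r => e.
  by rewrite -[LHS]opprK -mulNmx opprB -[u - _]/(u - 1) mulmxE -e opprK.
split=> //; exists (\sum_(i < n) u ^+ i); have Vu := mulmx1C uV.
by split=> //; apply: is_hom_inv uh.
Qed.

Lemma ract_unip (a : Ga K R) : unip_aut s (fun X => ract X a).
Proof.
have span (b : Ga K R) X : ext_span (is_hom X X) (ract X b).
  have [n Xn] := infgen_nilp charK0 X; rewrite (ract_exp charK0 b Xn).
  by apply: ext_span_sum => k _; apply: infgen_pow_hom.
split.
- exact: (ract_tens_aut s a).1.
- exact: span.
- have [b [ab ba]] := gmulV a; exists (fun X => ract X b); split; first exact: span.
  by move=> X; rewrite -!ractM ab ba ract1.
- move=> X; have [n Xn] := infgen_nilp charK0 X.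
  have XnS : infgen X ^+ n.+1 = 0 by rewrite exprS Xn mulr0.
  rewrite (ract_exp charK0 a XnS) big_ord_recl /= fact0 invr1 !scale1r extmx1 addrC addKr.
  by apply: ext_span_sum => k _; apply: infgen_pow_rad.
Qed.

(** A morphism in End(V) with nonzero corner is invertible, hence not in the
radical. *)
Lemma rad_std (f : 'M[K]_2) : rad V V f -> [/\ f 0 0 = 0, f 1 0 = 0 & f 1 1 = 0].
Proof.
move=> [fh fr]; have f00 : f 0 0 = 0.
  apply/eqP/negPn/negP => f0; have fu := sym_end_unit charK0 fh f0.
  have fVh : is_hom V V (invmx f) by apply: is_hom_inv fh; rewrite ?mulmxV ?mulVmx.
  have [_ [g [_ _]]] := fr _ fVh.
  rewrite mulVmx // subrr mul0mx => /matrixP/(_ 0 0)/eqP.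
  by rewrite !mxE eqxx eq_sym oner_eq0.
split=> //; first exact: (sym_hom_low0 charK0 fh).
have := sym_hom_diag charK0 fh (leqnn 1) (leqnn 1); rewrite !inord0.
rewrite (_ : inord 1 = 1); first by move->.
by apply: val_inj; rewrite /= inordK.
Qed.

Lemma ext_span_rad_std (N : 'M[R]_2) :
  ext_span (rad V V) N -> [/\ N 0 0 = 0, N 1 0 = 0 & N 1 1 = 0].
Proof.
elim=> [|a f M /rad_std[f00 f10 f11] _ [M00 M10 M11]]; first by split; rewrite mxE.
by split; rewrite !mxE ?f00 ?f10 ?f11 ?M00 ?M10 ?M11 /= scale0r mulr0 addr0.
Qed.

(** Elements of rad(V, V) are multiples of the generator of V, whose only nonzero
entry is at (0, 1). *)
Lemma unip_std (g : pU s R) : sval g V = phi_mx (sval g V 0 1).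
Proof.
have [_ _ _ /(_ V)/ext_span_rad_std] := svalP g.
set A := sval g V; rewrite !mxE => -[/subr0_eq A00 A10 /subr0_eq A11].
apply/matrixP => i j; rewrite phi_mxE.
case: (ord2P i) => ->; case: (ord2P j) => -> /=; rewrite ?bin0 ?bin1 ?expr0 ?expr1 ?mulr1n //.
by move: A10; rewrite subr0 => ->.
Qed.

Definition unip_pt (g : pU s R) : Ga K R := sval g V 0 1.

Lemma unip_ptM (g h : pU s R) : unip_pt (gmul g h) = gmul (unip_pt g) (unip_pt h).
Proof.
have e : sval (gmul g h) V = phi_mx (unip_pt g + unip_pt h).
  by rewrite phi_mxD -!unip_std.
by rewrite /unip_pt e phi_mxE bin0 mulr1n expr1.
Qed.

(** The inverse maps a to its action on all representations; that every point is
of this form follows from tens_end_uniq. *)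
Lemma unip_pt_bij : bijective unip_pt.
Proof.
exists (fun a => exist _ _ (ract_unip a) : pU s R) => [g|a].
  apply: mxfam_eqP => X; apply: (tens_end_uniq charK0).
  - exact: (ract_tens_aut s (unip_pt g)).1.
  - by case: (svalP g).
  - by rewrite [RHS]unip_std; apply: std_act.
transitivity (phi_mx (a : R) 0 1); first by rewrite -(std_act (a : Ga K R)).
by rewrite phi_mxE bin0 mulr1n expr1.
Qed.
End Unip.

Lemma unip_pt_nat (R S : comAlgType K) (f : {lrmorphism R -> S}) (g : pU s R) :
  unip_pt (kmap (pU s) f g) = kmap (Ga K) f (unip_pt g).
Proof. by rewrite /unip_pt /= mxE. Qed.

Definition unip_hom : khom (pU s) (Ga K) := KHom (@unip_ptM) unip_pt_nat.

End Envelope.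

Theorem mainTheorem12 (K : fieldType) (charK0 : [pchar K]%R =i pred0)
    (s : monoidal_section (Ga K)) :
  (exists f : khom (pU s) (Ga K), kiso f) /\
  (exists Phi : khom (pRed s) (SL2 K),
     kiso Phi /\
     forall (R : comAlgType K) (a : Ga K R), Phi R (sharp s R a) = phi K R a).
Proof.
split; first by exists (unip_hom charK0 s) => R; apply: unip_pt_bij.
exists (red_hom charK0 s); split; first exact: red_hom_iso.
exact: red_hom_sharp.
Qed.
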